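(* Let ${\bf i}=(i_1,\dots,i_r)\in I^r$ be a reduced word for $w\in W$, and let ${\bf B}^{\rm up}=\{\Xi^{\rm up}(b)\mid b\in\mathcal{B}(\infty)\}\subset\mathbb{C}[U^-]$ be a perfect basis with the following positivity properties: (i) $(-f_i)\cdot\Xi^{\rm up}(b)\in\sum_{b'\in\mathcal{B}(\infty)}\mathbb{R}_{\ge0}\Xi^{\rm up}(b')$ for all $b\in\mathcal{B}(\infty)$, $i\in I$; (ii) $\Xi^{\rm up}(\tilde f_ib_\infty)\cdot\Xi^{\rm up}(b)\in\sum_{b'\in\mathcal{B}(\infty)}\mathbb{R}_{\ge0}\Xi^{\rm up}(b')$ for all $b\in\mathcal{B}(\infty)$, $i\in I$. Then for all $b\in\mathcal{B}_w(\infty)$, \[v_{\bf i}^{\rm low}(\Xi^{\rm up}_w(b))=-\tilde v_{\bf i}^{\rm high}(\Xi^{\rm up}_w(b))^{\rm op}\quad\text{and}\quad\tilde v_{\bf i}^{\rm low}(\Xi^{\rm up}_w(b))=-v_{\bf i}^{\rm high}(\Xi^{\rm up}_w(b))^{\rm op},\] where $(a_1,\dots,a_r)^{\rm op}=(a_r,\dots,a_1)$.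
   Context: **Lie theory.** $G$ is a connected, simply-connected semisimple algebraic group over $\mathbb{C}$, $\mathfrak g$ its Lie algebra, $B\subset G$ a Borel subgroup, $W$ the Weyl group with simple reflections $s_i$ ($i\in I$), $\alpha_i$ simple roots, $h_i$ simple coroots, $e_i,f_i,h_i$ Chevalley generators. $U^-$ is the unipotent radical of the opposite Borel, $\mathfrak u^-={\rm Lie}(U^-)$; $U(\mathfrak u^-)=\bigoplus_{{\bf d}\in\mathbb{Z}_{\ge0}^I}U(\mathfrak u^-)_{\bf d}$ is graded by putting $f_i$ in degree the $i$-th unit vector. **Perfect bases.** The graded dual $U(\mathfrak u^-)^*_{\rm gr}=\bigoplus_{\bf d}{\rm Hom}_{\mathbb C}(U(\mathfrak u^-)_{\bf d},\mathbb{C})$ is identified (as Hopf algebra) with $\mathbb{C}[U^-]$ through the pairing $\langle f,f_{j_1}\cdots f_{j_m}\rangle=\frac{\partial^m}{\partial t_1\cdots\partial t_m}\big|_{t=0}f(\exp(t_1f_{j_1})\cdots\exp(t_mf_{j_m}))$. It is a $U(\mathfrak u^-)$-bimodule via $\langle x\cdot\rho,y\rangle=-\langle\rho,xy\rangle$, $\langle\rho\cdot x,y\rangle=-\langle\rho,yx\rangle$ for $x\in\mathfrak u^-$, $y\in U(\mathfrak u^-)$. Let $*$ be the algebra anti-involution of $U(\mathfrak u^-)$ with $f_i^*=f_i$, and also its transpose on $\mathbb{C}[U^-]$. Put $\varepsilon_i(f)=\max\{k\ge0\mid f_i^k\cdot f\ne0\}$ for $f\ne0$, $\varepsilon_i(0)=-\infty$,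 and $\mathbb{C}[U^-]^{<k,i}=\{f\mid\varepsilon_i(f)<k\}$. A $\mathbb{C}$-basis ${\bf B}^{\rm up}$ of $\mathbb{C}[U^-]$ is *perfect* if: it consists of homogeneous elements; its only element of degree $0$ is $\tau_\infty$ with $\langle\tau_\infty,1\rangle=1$; for $i\in I$, $\tau\in{\bf B}^{\rm up}$ with $f_i\cdot\tau\ne0$ there is a unique $\tilde e_i(\tau)\in{\bf B}^{\rm up}$ with $f_i\cdot\tau\in\mathbb{C}^\times\tilde e_i(\tau)+\mathbb{C}[U^-]^{<\varepsilon_i(\tau)-1,i}$; $\tilde e_i(\tau)=\tilde e_i(\tau')$ implies $\tau=\tau'$; and $({\bf B}^{\rm up})^*={\bf B}^{\rm up}$. Put $\tilde e_i(\tau)=0$ if $f_i\cdot\tau=0$, $\tilde f_i(\tau)=\tau'$ if $\tilde e_i(\tau')=\tau$ and $\tilde f_i(\tau)=0$ if no such $\tau'$ exists, ${\rm wt}(\tau)=-\sum d_i\alpha_i$ for $\tau$ of degree ${\bf d}$, $\varphi_i(\tau)=\varepsilon_i(\tau)+\langle{\rm wt}(\tau),h_i\rangle$. Then ${\bf B}^{\rm up}$ is a crystal, and (Berenstein–Kazhdan) there is a unique crystal isomorphism from ${\bf B}^{\rm up}$ to Kashiwara's crystal $\mathcal{B}(\infty)$ of the negative half of the quantized enveloping algebra; $\Xi^{\rm up}(b)$ denotes the element corresponding to $b\in\mathcal{B}(\infty)$. $b_\infty$ is the element of weight $0$ of $\mathcal{B}(\infty)$. For a reduced word ${\bf i}$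 of $w$, $\mathcal{B}_w(\infty)=\{\tilde f_{i_1}^{a_1}\cdots\tilde f_{i_r}^{a_r}b_\infty\mid a_k\ge0\}$ (independent of ${\bf i}$). **Geometry and valuations.** $X(w)\subset G/B$ is the Schubert variety (closure of $B\widetilde wB/B$, $\widetilde w$ a lift of $w$); $U^-$ is embedded as an open subset of $G/B$ by $u\mapsto u\bmod B$, and $U^-\cap X(w)$ is a closed subvariety of $U^-$. $\Xi^{\rm up}_w(b)\in\mathbb{C}[U^-\cap X(w)]$ is the restriction of $\Xi^{\rm up}(b)$. The map $(t_1,\dots,t_r)\mapsto\exp(t_1f_{i_1})\cdots\exp(t_rf_{i_r})\bmod B$ is a birational morphism $\mathbb{C}^r\to U^-\cap X(w)$, so $\mathbb{C}[U^-\cap X(w)]\subset\mathbb{C}[t_1,\dots,t_r]$ and $\mathbb{C}(X(w))=\mathbb{C}(t_1,\dots,t_r)$. For a nonzero polynomial $f$ let $M(f)\subset\mathbb{Z}_{\ge0}^r$ be the set of exponents $(a_1,\dots,a_r)$ of monomials $t_1^{a_1}\cdots t_r^{a_r}$ with nonzero coefficient in $f$. With the lexicographic order on $\mathbb{Z}^r$ (first differing coordinate decides): $v_{\bf i}^{\rm high}(f)=-\max M(f)$, $v_{\bf i}^{\rm low}(f)=\min M(f)$, $\tilde v_{\bf i}^{\rm high}(f)=-\max\{(a_r,\dots,a_1)\mid(a_1,\dots,a_r)\in M(f)\}$, $\tilde v_{\bf i}^{\rm low}(f)=\min\{(a_r,\dots,a_1)\mid(a_1,\dots,a_r)\in M(f)\}$;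 each is extended to $\mathbb{C}(X(w))\setminus\{0\}$ by $v(f/g)=v(f)-v(g)$. *)

(* Defs.v *)
(* The field of complex numbers is R[i] for a realType R. *)
From HB Require Import structures.
From mathcomp Require Import all_boot all_order all_algebra.
From mathcomp Require Import fraction.
From mathcomp Require Import boolp classical_sets reals complex mpoly.

Set Implicit Arguments.
Unset Strict Implicit.
Unset Printing Implicit Defensive.

Import Order.TTheory GRing.Theory Num.Theory.
Local Open Scope classical_set_scope.
Local Open Scope ring_scope.

Definition pick_some (T : Type) (P : T -> Prop) : option T :=
  if pselect (exists x, P x) is left h then Some (projT1 (cid h)) else None.

(* The number of occurrences of each letter: the degree in Z_{>=0}^I of the
   monomial f_{j_1} ... f_{j_m}. *)
Definition content (I : finType) (j : seq I) : {ffun I -> nat} :=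
  [ffun i => count_mem i j].

(* Every affine algebraic group is a Zariski closed subgroup of some GL_N; the
   size is written n.+1 because square matrices form a ring only then. *)

Section AlgebraicGroups.
Variable R : realType.
Local Notation C := R[i].

Definition mxeval n (P : {mpoly C[n.+1 * n.+1]}) (g : 'M[C]_n.+1) : C :=
  P.@[fun k => mxvec g 0 k].

Section Fixed.
Variable n : nat.
Local Notation M := 'M[C]_n.+1.
Implicit Types (H K V S Z : set M) (g h u v X Y : M).

Definition zclosed Z : Prop :=
  exists S : set {mpoly C[n.+1 * n.+1]}, forall g,
    Z g <-> g \is a GRing.unit /\ forall P, S P -> mxeval P g = 0.

Definition subgroup H : Prop :=
  [/\ H 1, forall g, H g -> g \is a GRing.unit,
      forall g h, H g -> H h -> H (g * h) & forall g, H g -> H g^-1].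

Definition closed_subgroup H : Prop := subgroup H /\ zclosed H.

Definition zconnected H : Prop :=
  forall Z1 Z2, zclosed Z1 -> zclosed Z2 -> H `<=` Z1 `|` Z2 ->
    H `&` Z1 `&` Z2 = set0 -> H `<=` Z1 \/ H `<=` Z2.

Definition generated_subgroup S : set M :=
  [set g | forall H, subgroup H -> S `<=` H -> H g].

Definition derived H : set M :=
  generated_subgroup
    [set x | exists g h, [/\ H g, H h & x = g^-1 * h^-1 * g * h]].

Definition solvable H : Prop := exists k, iter k derived H `<=` [set 1].

Definition normal_in V H : Prop :=
  V `<=` H /\ forall g v, H g -> V v -> V (g * v * g^-1).

Definition unipotent V : Prop := forall v, V v -> (v - 1) ^+ n.+1 = 0.

Definition diagonalizable_group V : Prop :=
  exists2 P : M, P \is a GRing.unit &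
    forall v, V v -> is_diag_mx (P * v * P^-1).

Definition semisimple H : Prop :=
  [/\ closed_subgroup H, zconnected H &
      forall V, closed_subgroup V -> zconnected V -> solvable V ->
        normal_in V H -> V `<=` [set 1]].

Definition borel H B : Prop :=
  let P V := [/\ closed_subgroup V, zconnected V, solvable V & V `<=` H] in
  P B /\ forall V, P V -> B `<=` V -> V `<=` B.

Definition maximal_torus H T : Prop :=
  let P V := [/\ closed_subgroup V, zconnected V, diagonalizable_group V
                 & V `<=` H] in
  P T /\ forall V, P V -> T `<=` V -> V `<=` T.

Definition unipotent_radical H U : Prop :=
  let P V := [/\ closed_subgroup V, zconnected V, unipotent V
                 & normal_in V H] in
  P U /\ forall V, P V -> V `<=` U.

Definition normalizer H T : set M :=
  [set g | H g /\ forall t, T t <-> T (g * t * g^-1)].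

(* The tangent space at 1: the differential at 1 of every polynomial vanishing
   on H vanishes at X. *)
Definition Lie H : set M :=
  [set X | forall P : {mpoly C[n.+1 * n.+1]},
     (forall g, H g -> mxeval P g = 0) ->
     \sum_k mxeval (mderiv k P) 1 * mxvec X 0 k = 0].

Definition brk X Y : M := X * Y - Y * X.

Definition Lie_subalgebra (L : set M) : Prop :=
  [/\ L 0, forall X Y, L X -> L Y -> L (X + Y),
      forall (c : C) X, L X -> L (c *: X)
    & forall X Y, L X -> L Y -> L (brk X Y)].

Definition generated_Lie (S : set M) : set M :=
  [set X | forall L, Lie_subalgebra L -> S `<=` L -> L X].

(* For nilpotent X, whose powers beyond the n-th vanish. *)
Definition mexp X : M := \sum_(k < n.+1) (k`!%:R : C)^-1 *: X ^+ k.

Definition regular_on Z (phi : M -> C) : Prop :=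
  exists P k, forall g, Z g -> phi g = mxeval P g / (\det g) ^+ k.

End Fixed.

Definition algebraic_morphism m n (H : set 'M[C]_m.+1) (K : set 'M[C]_n.+1)
    (phi : 'M[C]_m.+1 -> 'M[C]_n.+1) : Prop :=
  [/\ forall h, H h -> K (phi h),
      forall g h, H g -> H h -> phi (g * h) = phi g * phi h
    & forall i j, regular_on H (fun h => phi h i j)].

(* Every isogeny from a connected algebraic group is an isomorphism; over a field
   of characteristic 0 isogenies are the surjections with finite kernel. *)
Definition simply_connected n (K : set 'M[C]_n.+1) : Prop :=
  forall m (H : set 'M[C]_m.+1) (phi : 'M[C]_m.+1 -> 'M[C]_n.+1),
    closed_subgroup H -> zconnected H -> algebraic_morphism H K phi ->
    (forall g, K g -> exists2 h, H h & phi h = g) ->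
    (exists s : seq 'M[C]_m.+1, forall h, H h -> phi h = 1 -> h \in s) ->
    exists2 psi, algebraic_morphism K H psi &
      (forall h, H h -> psi (phi h) = h) /\ (forall g, K g -> phi (psi g) = g).

Section Roots.
Variables (n : nat) (G B T : set 'M[C]_n.+1).
Local Notation M := 'M[C]_n.+1.

(* Roots are linear forms on Lie T, represented by functions on matrices of
   which only the values on Lie T matter. *)
Definition eq_on_T (beta gamma : M -> C) : Prop :=
  forall X, Lie T X -> beta X = gamma X.

Definition root_vector (beta : M -> C) (X : M) : Prop :=
  [/\ Lie G X, X <> 0 & forall Y, Lie T Y -> brk Y X = beta Y *: X].

Definition positive_root (beta : M -> C) : Prop :=
  ~ eq_on_T beta (fun=> 0) /\ exists2 X, root_vector beta X & Lie B X.

Definition simple_root (beta : M -> C) : Prop :=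
  positive_root beta /\
  ~ exists gamma delta, [/\ positive_root gamma, positive_root delta
                          & eq_on_T beta (fun X => gamma X + delta X)].

End Roots.

Record pinned_group (n : nat) (I : finType) := PinnedGroup {
  pgG : set 'M[C]_n.+1;
  pgB : set 'M[C]_n.+1;
  pgBm : set 'M[C]_n.+1;
  pgT : set 'M[C]_n.+1;
  pgU : set 'M[C]_n.+1;
  pgUm : set 'M[C]_n.+1;
  pg_alpha : I -> 'M[C]_n.+1 -> C;
  chev_e : I -> 'M[C]_n.+1;
  chev_f : I -> 'M[C]_n.+1;
  chev_h : I -> 'M[C]_n.+1;
  cartan : I -> I -> int;
  pg_semisimple : semisimple pgG;
  pg_simply_connected : simply_connected pgG;
  pg_borel : borel pgG pgB;
  pg_torus : maximal_torus pgG pgT;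
  pg_borel_opp : borel pgG pgBm;
  pg_opposite : pgB `&` pgBm = pgT;
  pg_radical : unipotent_radical pgB pgU;
  pg_radical_opp : unipotent_radical pgBm pgUm;
  pg_simple : forall i, simple_root pgG pgB pgT (pg_alpha i);
  pg_simple_all : forall beta, simple_root pgG pgB pgT beta ->
    exists i, eq_on_T pgT beta (pg_alpha i);
  pg_simple_inj : forall i j, eq_on_T pgT (pg_alpha i) (pg_alpha j) -> i = j;
  pg_e : forall i, root_vector pgG pgT (pg_alpha i) (chev_e i);
  pg_f : forall i, root_vector pgG pgT (fun X => - pg_alpha i X) (chev_f i);
  pg_ef : forall i j,
    brk (chev_e i) (chev_f j) = if i == j then chev_h i else 0;
  pg_cartan : forall i j, pg_alpha j (chev_h i) = (cartan i j)%:~R;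
  pg_cartan_diag : forall i, cartan i i = 2;
  pg_gen_T : forall X, Lie pgT X <->
    exists c : I -> C, X = \sum_i c i *: chev_h i;
  pg_free_T : forall c : I -> C,
    \sum_i c i *: chev_h i = 0 -> forall i, c i = 0;
  pg_gen_U : Lie pgU = generated_Lie (range chev_e);
  pg_gen_Um : Lie pgUm = generated_Lie (range chev_f)
}.

Section Pinned.
Variables (n : nat) (I : finType) (D : pinned_group n I).
Local Notation M := 'M[C]_n.+1.
Local Notation G := (pgG D).
Local Notation B := (pgB D).
Local Notation T := (pgT D).
Local Notation Um := (pgUm D).
Implicit Types (w u g : M) (phi tau rho : M -> C).

(* Elements of W = N_G(T)/T are represented by lifts in N_G(T). *)
Definition reflection (i : I) (X : M) : M := X - pg_alpha D i X *: chev_h D i.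

Definition word_for (j : seq I) w : Prop :=
  forall X, Lie T X -> w * X * w^-1 = foldr reflection X j.

Definition reduced_word (j : seq I) w : Prop :=
  [/\ normalizer G T w, word_for j w
    & forall j', word_for j' w -> (size j <= size j')%N].

(* The preimage in G of X(w): a subset of G/B is closed iff its preimage in G,
   which is stable under right translation by B, is closed. *)
Definition schubert w : set M :=
  [set g | forall Z, zclosed Z ->
     (forall z b, Z z -> B b -> Z (z * b)) ->
     (forall b b', B b -> B b' -> Z (b * w * b')) -> Z g].

Definition Um_schubert w : set M := Um `&` schubert w.

(* A regular function on the closed subset U^- is represented by its extension
   by zero, so that two of them are equal iff they agree on U^-. *)
Definition CU : set (M -> C) :=
  [set phi | regular_on Um phi /\ forall g, ~ Um g -> phi g = 0].

Definition restriction (Z : set M) phi : M -> C :=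
  fun u => if `[< Z u >] then phi u else 0.

Definition exp_path r (j : r.-tuple I) (t : 'I_r -> C) : M :=
  \prod_(k < r) mexp (t k *: chev_f D (tnth j k)).

Definition pullback r (j : r.-tuple I) phi : {mpoly C[r]} :=
  xget 0 [set p : {mpoly C[r]} | forall t, p.@[t] = phi (exp_path j t)].

(* The inclusion of C[U^- /\ X(w)] in C[t_1, ..., t_r] sends psi to p; for psi
   the restriction of phi in C[U^-], p is pullback j phi. *)
Definition in_coordinates w r (j : r.-tuple I) (psi : M -> C)
    (p : {mpoly C[r]}) : Prop :=
  forall t, Um_schubert w (exp_path j t) -> psi (exp_path j t) = p.@[t].

(* <phi, f_{j_1} ... f_{j_m}> *)
Definition pairing phi (j : seq I) : C :=
  (mderivm [multinom 1%N | _ < size j] (pullback (in_tuple j) phi)).@[fun=> 0].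

(* The monomials in the f_i of content d span the d-th component of the
   enveloping algebra. *)
Definition homogeneous phi (d : {ffun I -> nat}) : Prop :=
  CU phi /\ forall j, pairing phi j <> 0 -> content j = d.

(* f_i . phi *)
Definition act (i : I) phi : M -> C :=
  xget (fun=> 0)
    [set psi | CU psi /\ forall j, pairing psi j = - pairing phi (i :: j)].

(* phi^* *)
Definition star phi : M -> C :=
  xget (fun=> 0)
    [set psi | CU psi /\ forall j, pairing psi j = pairing phi (rev j)].

Definition eps_is (i : I) phi (k : nat) : Prop :=
  iter k (act i) phi <> (fun=> 0) /\
  forall m, iter m (act i) phi <> (fun=> 0) -> (m <= k)%N.

Definition CU_lt (i : I) (k : nat) : set (M -> C) :=
  [set phi | CU phi /\
     (phi = (fun=> 0) \/ exists2 m, eps_is i phi m & (m < k)%N)].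

Definition combination (c : set C) (S : set (M -> C)) : set (M -> C) :=
  [set phi | exists m (a : 'I_m -> C) (tau : 'I_m -> M -> C),
     (forall k, c (a k) /\ S (tau k)) /\
     phi = (fun u => \sum_k a k * tau k u)].

Definition is_basis (S : set (M -> C)) : Prop :=
  [/\ S `<=` CU, CU `<=` combination setT S
    & forall m (a : 'I_m -> C) (tau : 'I_m -> M -> C),
        injective tau -> (forall k, S (tau k)) ->
        (forall u, \sum_k a k * tau k u = 0) -> forall k, a k = 0].

(* tau' = e~_i(tau).  As f_i . tau <> 0, the exponent k.-1 is a true
   predecessor. *)
Definition etilde_rel (S : set (M -> C)) (i : I) tau tau' : Prop :=
  [/\ S tau, S tau', act i tau <> (fun=> 0)
    & exists (c : C) (k : nat), [/\ c <> 0, eps_is i tau k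
        & CU_lt i k.-1 (fun u => act i tau u - c * tau' u)]].

Record perfect_basis (S : set (M -> C)) : Prop := {
  pb_basis : is_basis S;
  pb_homogeneous : forall tau, S tau -> exists d, homogeneous tau d;
  pb_degree0 : exists tau0, pairing tau0 [::] = 1 /\
    forall tau, S tau /\ homogeneous tau [ffun=> 0%N] <-> tau = tau0;
  pb_etilde : forall i tau, S tau -> act i tau <> (fun=> 0) ->
    exists! tau', etilde_rel S i tau tau';
  pb_etilde_inj : forall i tau tau' sigma,
    etilde_rel S i tau sigma -> etilde_rel S i tau' sigma -> tau = tau';
  pb_star : [set star tau | tau in S] = S
}.

(* The operators e~_i, f~_i take values in the set of elements together with a
   formal zero, None; weights are given by their coordinates on the simple
   roots. *)
Record crystal := Crystal {
  cr_sort : Type;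
  cr_elt : set cr_sort;
  cr_wt : cr_sort -> {ffun I -> int};
  cr_eps : I -> cr_sort -> int;
  cr_phi : I -> cr_sort -> int;
  cr_e : I -> cr_sort -> option cr_sort;
  cr_f : I -> cr_sort -> option cr_sort
}.

Record crystal_iso (X Y : crystal) (psi : cr_sort X -> cr_sort Y) : Prop := {
  ci_elt : forall x, cr_elt x -> cr_elt (psi x);
  ci_inj : forall x y, cr_elt x -> cr_elt y -> psi x = psi y -> x = y;
  ci_surj : forall y, cr_elt y -> exists2 x, cr_elt x & psi x = y;
  ci_wt : forall x, cr_elt x -> cr_wt (psi x) = cr_wt x;
  ci_eps : forall i x, cr_elt x -> cr_eps i (psi x) = cr_eps i x;
  ci_phi : forall i x, cr_elt x -> cr_phi i (psi x) = cr_phi i x;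
  ci_e : forall i x, cr_elt x -> cr_e i (psi x) = omap psi (cr_e i x);
  ci_f : forall i x, cr_elt x -> cr_f i (psi x) = omap psi (cr_f i x)
}.

Definition minus_deg (d : {ffun I -> nat}) : {ffun I -> int} :=
  [ffun i => - (d i)%:Z].

(* <wt, h_i> *)
Definition coroot_pairing (wt : {ffun I -> int}) (i : I) : int :=
  \sum_j wt j * cartan D i j.

Definition perfect_crystal (S : set (M -> C)) : crystal :=
  let wt tau := minus_deg (xget [ffun=> 0%N] (homogeneous tau)) in
  let eps i tau := (xget 0%N (eps_is i tau))%:Z in
  {| cr_sort := M -> C;
     cr_elt := S;
     cr_wt := wt;
     cr_eps := eps;
     cr_phi := fun i tau => eps i tau + coroot_pairing (wt tau) i;
     cr_e := fun i tau => pick_some (etilde_rel S i tau);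
     cr_f := fun i tau => pick_some (etilde_rel S i ^~ tau) |}.

(* f~_{i_1}^{a_1} ... f~_{i_r}^{a_r} x for some a_1, ..., a_r >= 0 *)
Definition demazure (X : crystal) (x : cr_sort X) r (j : r.-tuple I) :
    set (cr_sort X) :=
  [set b | cr_elt b /\ exists a : r.-tuple nat,
     foldr (fun ja => iter ja.2 (obind (cr_f ja.1))) (Some x) (zip j a)
     = Some b].

End Pinned.

End AlgebraicGroups.

(* Conventions of Kashiwara, "On crystal bases of the q-analogue of universal
   enveloping algebras": base field Q(q), q_i = q^((alpha_i, alpha_i)/2), and
   crystallization at q = 0. *)

Definition Qq := {fraction {poly rat}}.
Definition qvar : Qq := tofrac 'X.

Definition regular0 (c : Qq) : Prop :=
  exists p r : {poly rat}, r.[0] != 0 /\ c = tofrac p / tofrac r.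

Definition qint (v : Qq) (k : nat) : Qq := (v ^+ k - v ^- k) / (v - v^-1).
Definition qfact (v : Qq) (k : nat) : Qq := \prod_(1 <= m < k.+1) qint v m.

Section QuantumMinus.
Variables (I : finType) (a : I -> I -> int).

Definition divided (d : I -> nat) (A : algType Qq) (F : I -> A) (i : I)
    (k : nat) : A := (qfact (qvar ^+ d i) k)^-1 *: F i ^+ k.

Definition qserre (d : I -> nat) (A : algType Qq) (F : I -> A) : Prop :=
  forall i j, i != j -> let m := `|1 - a i j|%N in
    \sum_(k < m.+1)
      (-1) ^+ k *: (divided d F i k * F j * divided d F i (m - k)) = 0.

(* U_q^- is the algebra presented by the q-Serre relations, with Kashiwara's
   operators e'_i; qm_d i is half the squared length of alpha_i. *)
Record quantum_minus := QuantumMinus {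
  qm_d : I -> nat;
  qm_alg : algType Qq;
  qm_F : I -> qm_alg;
  qm_e' : I -> {linear qm_alg -> qm_alg};
  qm_d_gt0 : forall i, (0 < qm_d i)%N;
  qm_sym : forall i j, (qm_d i)%:Z * a i j = (qm_d j)%:Z * a j i;
  qm_serre : qserre qm_d qm_F;
  qm_gen : forall x, exists s : seq (Qq * seq I),
    x = \sum_(p <- s) p.1 *: \prod_(i <- p.2) qm_F i;
  qm_univ : forall (A : algType Qq) (F : I -> A), qserre qm_d F ->
    exists phi : {lrmorphism qm_alg -> A}, forall i, phi (qm_F i) = F i;
  qm_e'1 : forall i, qm_e' i 1 = 0;
  qm_e'F : forall i j x, qm_e' i (qm_F j * x) =
    (i == j)%:R *: x
    + ((qvar ^+ qm_d i) ^ (- a i j)) *: (qm_F j * qm_e' i x)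
}.

Variable Q : quantum_minus.
Local Notation A := (qm_alg Q).
Implicit Types (x y z : A) (b : set A).

Definition qdivided (i : I) (k : nat) : A := divided (qm_d Q) (@qm_F Q) i k.

Definition string_decomp (i : I) x (m : nat) (u : nat -> A) : Prop :=
  (forall k, qm_e' Q i (u k) = 0) /\ x = \sum_(k < m) qdivided i k * u k.

Definition ftilde (i : I) x : A :=
  xget 0 [set y | exists m u, string_decomp i x m u /\
                    y = \sum_(k < m) qdivided i k.+1 * u k].

Definition etilde (i : I) x : A :=
  xget 0 [set y | exists m u, string_decomp i x m u /\
                    y = \sum_(k < m | (0 < k)%N) qdivided i k.-1 * u k].

Definition fword (j : seq I) : A := foldr ftilde 1 j.

(* L(infinity) *)
Definition lattice : set A :=
  [set x | exists s : seq (Qq * seq I),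
     (forall p, p \in s -> regular0 p.1) /\
     x = \sum_(p <- s) p.1 *: fword p.2].

Definition qlattice : set A := [set qvar *: x | x in lattice].

(* The class of x in L(infinity)/q L(infinity), as a subset of U_q^-. *)
Definition lclass x : set A := [set y | qlattice (y - x)].

Definition Binf : set (set A) :=
  [set b | exists j, b = lclass (fword j) /\ ~ qlattice (fword j)].

Definition qdegree x (d : {ffun I -> nat}) : Prop :=
  exists s : seq (Qq * seq I), (forall p, p \in s -> content p.2 = d) /\
    x = \sum_(p <- s) p.1 *: \prod_(i <- p.2) (@qm_F Q) i.

(* The operator induced by op on L(infinity)/q L(infinity), with the class 0
   turned into the formal zero. *)
Definition on_classes (op : A -> A) b : option (set A) :=
  pick_some (fun b' => exists x,
    [/\ lattice x, b = lclass x, ~ qlattice (op x) & b' = lclass (op x)]).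

Definition qeps_is (i : I) b (k : nat) : Prop :=
  iter k (obind (on_classes (etilde i))) (Some b) <> None /\
  forall m, iter m (obind (on_classes (etilde i))) (Some b) <> None ->
    (m <= k)%N.

Definition qdeg_is b (d : {ffun I -> nat}) : Prop :=
  exists x, [/\ lattice x, qdegree x d & b = lclass x].

Definition Binf_crystal : crystal I :=
  let wt b := minus_deg (xget [ffun=> 0%N] (qdeg_is b)) in
  let eps i b := (xget 0%N (qeps_is i b))%:Z in
  {| cr_sort := set A;
     cr_elt := Binf;
     cr_wt := wt;
     cr_eps := eps;
     cr_phi := fun i b => eps i b + \sum_j wt b j * a i j;
     cr_e := fun i b => on_classes (etilde i) b;
     cr_f := fun i b => on_classes (ftilde i) b |}.

Definition b_inf : cr_sort Binf_crystal := lclass 1.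

End QuantumMinus.

Arguments b_inf {I a} Q.

Section Valuations.
Variables (R : realType) (r : nat).
Implicit Types (p : {mpoly R[i][r]}) (s : seq (r.-tuplelexi nat)).

Definition lexmax s : r.-tuplelexi nat :=
  \big[Order.max/head [tuple of nseq r 0%N] s]_(x <- s) x.
Definition lexmin s : r.-tuplelexi nat :=
  \big[Order.min/head [tuple of nseq r 0%N] s]_(x <- s) x.

Definition exponents p : seq (r.-tuplelexi nat) :=
  [seq multinom_val m | m <- msupp p].
Definition rev_exponents p : seq (r.-tuplelexi nat) :=
  [seq [tuple of rev (multinom_val m)] | m <- msupp p].

Definition int_vector (x : r.-tuple nat) : 'rV[int]_r :=
  \row_k (tnth x k)%:Z.

Definition op (x : 'rV[int]_r) : 'rV[int]_r := \row_k x 0 (rev_ord k).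

Definition v_high p : 'rV[int]_r := - int_vector (lexmax (exponents p)).
Definition v_low p : 'rV[int]_r := int_vector (lexmin (exponents p)).
Definition vt_high p : 'rV[int]_r := - int_vector (lexmax (rev_exponents p)).
Definition vt_low p : 'rV[int]_r := int_vector (lexmin (rev_exponents p)).

End Valuations.

(* Main.v *)
(* By (i), the pairings of basis elements with monomials in the f_k are
   nonnegative, and the coefficient of t^a in the pullback of tau is the pairing
   with f_{i_1}^{a_1} ... f_{i_r}^{a_r} up to a positive factor; so the exponents
   of a nonnegative combination of basis elements are the union of theirs.  Let
   tau0 = e~_k tau and let x be the basis element f~_k of the unit, whose pullback
   is a multiple of the sum of the t_l with i_l = k.  Comparing the longest
   f_k-strings shows that tau0 occurs in -f_k.tau and that tau occurs in x tau0.
   Hence adding 1 to the first entry maps the exponents of tau0 to exponents of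
   tau when k = i_1, and every exponent of tau arises from one of tau0 by adding 1
   to an entry l with i_l = k.  By induction, starting from the bottom of the
   i_1-string, which only involves the word (i_2, ..., i_r), the lexicographically
   largest exponent of tau is also the smallest one for the reversed order.  This
   is the second identity; the first one is this for tau^* and the reversed
   word. *)
Require Import Defs.
From HB Require Import structures.
From mathcomp Require Import all_boot all_order all_algebra.
From mathcomp Require Import boolp classical_sets reals complex mpoly.
From mathcomp Require Import ring zify.

Set Implicit Arguments.
Unset Strict Implicit.
Unset Printing Implicit Defensive.

Import Order.TTheory GRing.Theory Num.Theory.
Local Open Scope classical_set_scope.
Local Open Scope ring_scope.

(** * Derivations of polynomial functions on matrices *)

(** The enveloping algebra is never built: a monomial in the f_k acts on polynomial functions of
    matrices by iterated derivations [lderiv], followed by evaluation at 1. The obstacle is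
    nondegeneracy: a function on U^- that pairs to zero with every word must vanish. Only Lie U^-,
    not U^-, is given as generated by the f_k, so one-parameter groups have to be integrated;
    polynomial matrices suffice for this because all the groups are unipotent. Positivity enters as
    absence of cancellation: a sum of nonnegative terms vanishes only if every term does, so that
    one leading term detects a basis element. Membership of b in B_w(infinity) supplies a first
    exponent: each f~_k of the defining product raises the leading entry, whence the pullback is
    nonzero. The quantum side contributes two facts: f~_k is well defined and preserves B(infinity),
    and b_inf is a nonzero class of weight 0, so that [Xi] sends it to the unit. The counit proves
    the second. *)

Section Derivations.
Variables (n : nat) (K : comNzRingType).

Lemma mderivU (k l : 'I_n) : ('X_l : {mpoly K[n]})^`M(k) = (k == l)%:R.
Proof.
rewrite mderivX mnm1E eq_sym; case: eqP => [->|_]; last by rewrite scale0r.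
suff -> : (U_(l) - U_(l) = 0)%MM by rewrite mpolyX0 scale1r.
by apply/mnmP=> j; rewrite mnmBE subnn mnm0E.
Qed.

Lemma mpoly_ring_ind (P : {mpoly K[n]} -> Prop) :
  (forall c, P c%:MP) -> (forall k, P 'X_k) ->
  (forall p q, P p -> P q -> P (p + q)) ->
  (forall p q, P p -> P q -> P (p * q)) -> forall p, P p.
Proof.
move=> PC PX PD PM p; rewrite (mpolyE p).
apply: big_ind => [|q1 q2|m _]; [exact: (PC 0) | exact: PD |].
rewrite -mul_mpolyC mpolyXE_id; apply: (PM); first exact: PC.
apply: big_ind => [|q1 q2|k _]; [exact: (PC 1) | exact: PM |].
elim: (m k) => [|e IH]; first by rewrite expr0; exact: (PC 1).
by rewrite exprS; apply: PM.
Qed.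

(** The chain rule for an abstract derivation [d]. It is applied to [deriv] along curves, to
    [mderiv] along paths, to [lderiv] itself, and to a commutator of two [lderiv]. *)
Lemma derivation_mmap (A : comNzRingType) (f : {rmorphism K -> A})
    (h : 'I_n -> A) (d : A -> A) :
  (forall x y, d (x + y) = d x + d y) ->
  (forall x y, d (x * y) = d x * y + x * d y) -> (forall c, d (f c) = 0) ->
  forall p, d (mmap f h p) = \sum_k mmap f h p^`M(k) * d (h k).
Proof.
move=> dD dM df; apply: mpoly_ring_ind => [c|k|p q Hp Hq|p q Hp Hq].
- rewrite mmapC df big1 // => k _.
  by rewrite mderivC mmap0 mul0r.
- rewrite mmapX mmap1U (bigD1 k) //= big1 => [|j jk]; rewrite mderivU.
    by rewrite eqxx rmorph1 mul1r addr0.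
  by rewrite (negPf jk) mmap0 mul0r.
- rewrite mmapD dD Hp Hq -big_split; apply: eq_bigr => k _ /=.
  by rewrite mderivD mmapD mulrDl.
- rewrite rmorphM dM Hp Hq mulr_suml mulr_sumr -big_split; apply: eq_bigr => k _ /=.
  by rewrite mderivM mmapD !rmorphM /= mulrDl -!mulrA [d (h k) * _]mulrC.
Qed.

End Derivations.

Section LeftDerivation.
Variables (n : nat) (K : comNzRingType).
Local Notation M := 'M[K]_n.+1.
Local Notation MP := {mpoly K[n.+1 * n.+1]}.

(** Coefficients are transported by [f] so that [P] can be evaluated at matrices over other rings:
    polynomial curves, paths in several variables, the generic matrix. *)
Definition mxev (A : comNzRingType) (f : K -> A) (U : 'M[A]_n.+1) (P : MP) : A :=
  mmap f (fun k => mxvec U 0 k) P.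

Definition generic_mx : 'M[MP]_n.+1 := vec_mx (\row_k 'X_k).

Lemma generic_mxE i j : generic_mx i j = 'X_(mxvec_index i j).
Proof. by rewrite !mxE. Qed.

(* At g this is the derivative at s = 0 of P((1 + s X) g). *)
Definition lderiv (X : M) (P : MP) : MP :=
  \sum_k P^`M(k) * mxvec (map_mx (@mpolyC _ K) X *m generic_mx) 0 k.

(** The last hypothesis is the equation U' = X U; along any of its solutions, differentiation is
    [lderiv X]. *)
Lemma mxev_lderiv (A : comNzRingType) (f : {rmorphism K -> A}) (d : A -> A)
    (U : 'M[A]_n.+1) (X : M) :
  (forall x y, d (x + y) = d x + d y) ->
  (forall x y, d (x * y) = d x * y + x * d y) -> (forall c, d (f c) = 0) ->
  map_mx d U = map_mx f X *m U ->
  forall P, d (mxev f U P) = mxev f U (lderiv X P).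
Proof.
move=> dD dM df dU P; rewrite /mxev derivation_mmap // rmorph_sum.
apply: eq_bigr => k _; rewrite rmorphM; congr (_ * _).
case/mxvec_indexP: k => i j; rewrite !mxvecE.
transitivity (map_mx d U i j); first by rewrite mxE.
rewrite dU !mxE rmorph_sum /=; apply: eq_bigr => l _.
rewrite rmorphM !mxE /= mmapC; congr (_ * _).
by rewrite mmapX mmap1U mxvecE.
Qed.

Lemma lderiv_ev (X : M) g P :
  mxev idfun g (lderiv X P)
  = \sum_k mxev idfun g P^`M(k) * mxvec (X *m g) 0 k.
Proof.
rewrite /mxev rmorph_sum; apply: eq_bigr => k _; rewrite rmorphM; congr (_ * _).
case/mxvec_indexP: k => i j; rewrite !mxvecE !mxE rmorph_sum.
apply: eq_bigr => l _.
by rewrite rmorphM !mxE /= mmapC mmapX mmap1U mxvecE.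
Qed.

Lemma lderivD X P P' : lderiv X (P + P') = lderiv X P + lderiv X P'.
Proof.
rewrite /lderiv -big_split; apply: eq_bigr => k _ /=.
by rewrite mderivD mulrDl.
Qed.

Lemma lderivM X P P' : lderiv X (P * P') = lderiv X P * P' + P * lderiv X P'.
Proof.
rewrite /lderiv mulr_suml mulr_sumr -big_split; apply: eq_bigr => k _ /=.
by rewrite mderivM mulrDl -!mulrA [_ * P']mulrC.
Qed.

Lemma lderivC X c : lderiv X c%:MP = 0.
Proof. by rewrite /lderiv big1 // => k _; rewrite mderivC mul0r. Qed.

Lemma lderivZ X c P : lderiv X (c *: P) = c *: lderiv X P.
Proof. by rewrite -mul_mpolyC lderivM lderivC mul0r add0r mul_mpolyC. Qed.

Lemma lderiv0 X : lderiv X 0 = 0.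
Proof. by have := lderivC X 0; rewrite mpolyC0. Qed.

Lemma lderivU X i j : lderiv X 'X_(mxvec_index i j)
  = \sum_l (X i l)%:MP * 'X_(mxvec_index l j).
Proof.
rewrite /lderiv (bigD1 (mxvec_index i j)) //= big1 => [|k kij]; rewrite mderivU.
  rewrite eqxx mul1r addr0 mxvecE mxE; apply: eq_bigr => l _.
  by rewrite !mxE.
by rewrite (negPf kij) mul0r.
Qed.

Lemma lderivE X P : lderiv X P = \sum_k P^`M(k) * lderiv X 'X_k.
Proof.
apply: eq_bigr => k _; congr (_ * _); case/mxvec_indexP: k => i j.
by rewrite lderivU mxvecE mxE; apply: eq_bigr => l _; rewrite !mxE.
Qed.

Lemma lderiv_linear0 P : lderiv 0 P = 0.
Proof.
rewrite /lderiv big1 // => k _; rewrite map_mx0 mul0mx.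
by rewrite raddf0 mxE mulr0.
Qed.

Lemma lderiv_addl X Y P : lderiv (X + Y) P = lderiv X P + lderiv Y P.
Proof.
rewrite /lderiv -big_split; apply: eq_bigr => k _ /=.
by rewrite map_mxD mulmxDl raddfD /= mxE mulrDr.
Qed.

Lemma lderiv_scalel c X P : lderiv (c *: X) P = c *: lderiv X P.
Proof.
rewrite /lderiv scaler_sumr; apply: eq_bigr => k _ /=.
by rewrite map_mxZ -scalemxAl linearZ /= mxE mulrCA mul_mpolyC.
Qed.

Let commutator_derivM (A : comNzRingType) (p q a b a' b' c e c' e' : A) :
  (a - b) * q + p * (a' - b')
  = a * q + c * e' + (e * c' + p * a') - (b * q + e * c' + (c * e' + p * b')).
Proof. ring. Qed.

(** Both sides are derivations killing constants, so it suffices to compare them on coordinates.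
    There [lderiv Z] replaces the generic matrix g by Z g, and composition reverses products: hence
    the order of the factors on the right. *)
Lemma lderiv_brk X Y P :
  lderiv (X *m Y - Y *m X) P = lderiv Y (lderiv X P) - lderiv X (lderiv Y P).
Proof.
pose d P := lderiv Y (lderiv X P) - lderiv X (lderiv Y P).
have dD p q : d (p + q) = d p + d q.
  by rewrite /d !lderivD opprD addrACA.
have dM p q : d (p * q) = d p * q + p * d q.
  rewrite /d !(lderivM, lderivD).
  move: (lderiv Y (lderiv X p)) (lderiv X (lderiv Y p)) (lderiv Y (lderiv X q))
    (lderiv X (lderiv Y q)) (lderiv X p) (lderiv Y p) (lderiv X q) (lderiv Y q).
  by move=> a b a' b' c e c' e'; rewrite -commutator_derivM.
have dC c : d c%:MP = 0 by rewrite /d !lderivC ?lderiv0 subr0.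
have lS (I : finType) Z (a : I -> K) (Q : I -> MP) :
    lderiv Z (\sum_l (a l)%:MP * Q l) = \sum_l (a l)%:MP * lderiv Z (Q l).
  rewrite (big_morph (lderiv Z) (lderivD Z) (lderiv0 Z)).
  by apply: eq_bigr => l _; rewrite lderivM lderivC mul0r add0r.
have comp Z Z' i j : lderiv Z' (lderiv Z 'X_(mxvec_index i j))
    = \sum_l ((Z *m Z') i l)%:MP * 'X_(mxvec_index l j).
  rewrite lderivU lS.
  transitivity (\sum_l \sum_m (Z i m * Z' m l)%:MP * 'X_(mxvec_index l j) : MP).
    rewrite exchange_big; apply: eq_bigr => l _ /=.
    rewrite lderivU mulr_sumr; apply: eq_bigr => m _.
    by rewrite mpolyCM mulrA.
  by apply: eq_bigr => l _; rewrite mxE rmorph_sum mulr_suml.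
(* [P] is rewritten as its own composition with the variables, to which the chain rule for [d]
   applies. *)
rewrite lderivE -[P in RHS]comp_mpoly_id -/(d _) /comp_mpoly derivation_mmap //.
apply: eq_bigr => k _; rewrite tnth_mktuple; congr (_ * _).
  by rewrite -/(comp_mpoly _ _) comp_mpoly_id.
case/mxvec_indexP: k => i j; rewrite /d !comp lderivU -sumrB.
by apply: eq_bigr => l _; rewrite !mxE mpolyCB mulrBl.
Qed.

End LeftDerivation.

(** * One-parameter groups of matrices *)

Lemma mxev_rmorph n (K A B : comNzRingType) (f : {rmorphism K -> A})
    (g : {rmorphism A -> B}) (U : 'M[A]_n.+1) P :
  g (mxev f U P) = mxev (g \o f) (map_mx g U) P.
Proof.
rewrite /mxev /mmap rmorph_sum; apply: eq_bigr => m _.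
rewrite rmorphM /mmap1 rmorph_prod; congr (_ * _); apply: eq_bigr => k _.
by rewrite rmorphXn; case/mxvec_indexP: k => i j; rewrite !mxvecE mxE.
Qed.

Section Flows.
Variables (n : nat) (K : numClosedFieldType).
Local Notation M := 'M[K]_n.+1.
Local Notation MP := {mpoly K[n.+1 * n.+1]}.
Implicit Types (X N : M) (P : MP).

Lemma poly_eq_nat (p q : {poly K}) :
  (forall m : nat, p.[m%:R] = q.[m%:R]) -> p = q.
Proof.
move=> pq; apply/eqP; rewrite -subr_eq0; apply/negP => /negP nz.
have inj : injective (fun m : nat => m%:R : K).
  by move=> a b /eqP; rewrite eqr_nat => /eqP.
have := max_poly_roots nz (rs := [seq m%:R | m <- iota 0 (size (p - q))]).
rewrite size_map size_iota ltnn => H; suff: false by []; apply: H.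
  by apply/allP => _ /mapP[m _ ->]; rewrite rootE !hornerE pq subrr.
by rewrite map_inj_uniq // iota_uniq.
Qed.

Lemma taylor_eq0 (q : {poly K}) : (forall k, q^`(k).[0] = 0) -> q = 0.
Proof.
move=> q0; apply/polyP => k; rewrite coef0; move: (q0 k).
rewrite horner_coef0 coef_derivn addn0 ffactnn => /eqP.
by rewrite mulrn_eq0 eqn0Ngt fact_gt0 => /eqP.
Qed.

Definition ev_mx (U : 'M[{poly K}]_n.+1) (t : K) : M := map_mx (horner^~ t) U.

(** A one-parameter group with generator [X], described by its differential equation and initial
    value. *)
Definition flow X (U : 'M[{poly K}]_n.+1) : Prop :=
  map_mx (@deriv K) U = map_mx polyC X *m U /\ ev_mx U 0 = 1.

Definition along (U : 'M[{poly K}]_n.+1) P : {poly K} := mxev polyC U P.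

Lemma along_ev U P t : (along U P).[t] = mxev idfun (ev_mx U t) P.
Proof.
rewrite -[LHS]/(horner_eval t _) /along mxev_rmorph /mxev; apply: eq_bigr => m _.
by rewrite /= /horner_eval hornerC.
Qed.

Lemma along_deriv X U P : map_mx (@deriv K) U = map_mx polyC X *m U ->
  (along U P)^`() = along U (lderiv X P).
Proof.
move=> dU; apply: (mxev_lderiv (d := @deriv K)) => //.
- exact: derivD.
- exact: derivM.
- exact: derivC.
Qed.

(** Every derivative at 0 of t |-> P(U(t)) is the value at 1 of a member of [J], hence zero, and
    Taylor's formula concludes. It serves both for the ideal of U^- and for the polynomials
    orthogonal to all words. *)
Lemma flow_vanish (J : MP -> Prop) X U P :
  flow X U -> (forall P, J P -> J (lderiv X P)) ->
  (forall P, J P -> mxev idfun 1 P = 0) -> J P ->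
  forall t, mxev idfun (ev_mx U t) P = 0.
Proof.
case=> dU U0 JX J1 JP t; rewrite -along_ev.
suff -> : along U P = 0 by rewrite horner0.
apply: taylor_eq0 => k.
have [Q JQ ->] : exists2 Q, J Q & (along U P)^`(k) = along U Q.
  elim: k => [|k [Q JQ IH]]; first by exists P.
  by exists (lderiv X Q); [exact: JX | rewrite derivnS IH (along_deriv _ dU)].
by rewrite along_ev U0; exact: J1.
Qed.

(** The parameter lives in any [K]-algebra: a number, the variable of a curve, or a coordinate of a
    path. *)
Definition expmx (A : comNzRingType) (f : {rmorphism K -> A}) X (x : A)
    : 'M[A]_n.+1 :=
  \sum_(k < n.+1) (f (k`!%:R)^-1 * x ^+ k) *: map_mx f (X ^+ k).

Lemma expmx_rmorph (A B : comNzRingType) (f : {rmorphism K -> A})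
    (g : {rmorphism A -> B}) (h : {rmorphism K -> B}) X x :
  (forall c, h c = g (f c)) ->
  map_mx g (expmx f X x) = expmx h X (g x).
Proof.
move=> hgf; rewrite /expmx raddf_sum; apply: eq_bigr => k _ /=.
rewrite map_mxZ rmorphM rmorphXn -hgf -map_mx_comp; congr (_ *: _).
by apply: eq_map_mx => c; rewrite /= hgf.
Qed.

Lemma expmx_deriv (A : comNzRingType) (f : {rmorphism K -> A}) (d : A -> A) X x :
  X ^+ n.+1 = 0 ->
  (forall x y, d (x + y) = d x + d y) ->
  (forall x y, d (x * y) = d x * y + x * d y) -> (forall c, d (f c) = 0) ->
  d x = 1 ->
  map_mx d (expmx f X x) = map_mx f X *m expmx f X x.
Proof.
move=> nilX dD dM df dx.
have d0 : d 0 = 0 by have := df 0; rewrite rmorph0.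
have d1 : d 1 = 0 by have := df 1; rewrite rmorph1.
have dX k : d (x ^+ k.+1) = k.+1%:R * x ^+ k.
  elim: k => [|k IH]; first by rewrite expr1 dx mul1r expr0.
  rewrite exprS dM dx IH mulrCA -exprS mul1r.
  by rewrite -[k.+2%:R]natr1 mulrDl mul1r addrC.
have -> : map_mx d (expmx f X x)
    = \sum_(k < n.+1) d (f (k`!%:R)^-1 * x ^+ k) *: map_mx f (X ^+ k).
  apply/matrixP=> i j; rewrite mxE /expmx !summxE (big_morph d dD d0).
  by apply: eq_bigr => k _; rewrite !mxE dM df mulr0 addr0.
(* The constant term is lost on the left by differentiation, the top term on the right by
   nilpotency; the rest matches after a shift of index. *)
rewrite /expmx mulmx_sumr big_ord_recl [RHS]big_ord_recr /=.
rewrite -scalemxAr -map_mxM -[X *m X ^+ n]/(X * X ^+ n) -exprS nilX map_mx0 scaler0 addr0.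
rewrite expr0 mulr1 df scale0r add0r; apply: eq_bigr => k _.
rewrite -scalemxAr -map_mxM -[X *m X ^+ _]/(X * X ^+ _) -exprS; congr (_ *: _).
rewrite dM df mul0r add0r dX mulrA -[X in _ * X * _](rmorph_nat f) -rmorphM; congr (f _ * _).
rewrite factS natrM invfM mulrAC mulVf ?mul1r //.
by rewrite pnatr_eq0.
Qed.

Lemma expmx_flow X : X ^+ n.+1 = 0 -> flow X (expmx polyC X 'X).
Proof.
move=> nilX; split.
  apply: expmx_deriv => //; [exact: derivD | exact: derivM | exact: derivC | exact: derivX].
apply/matrixP=> i j; rewrite mxE /expmx summxE.
rewrite -[LHS]/(horner_eval 0 _) rmorph_sum big_ord_recl big1 => [|k _].
  by rewrite !mxE fact0 invr1 !expr0 mulr1 /= /horner_eval !hornerE.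
by rewrite !mxE /= /horner_eval !hornerM hornerXn expr0n mulr0 mul0r.
Qed.

(** The binomial coefficient [t] over [k] as a polynomial in [t]. *)
Definition binp k : {poly K} :=
  (k`!%:R)^-1 *: \prod_(i < k) ('X - (i%:R)%:P).

Lemma binpE k (m : nat) : (binp k).[m%:R] = 'C(m, k)%:R.
Proof.
rewrite /binp hornerZ horner_prod.
have -> : \prod_(i < k) ('X - (i%:R)%:P).[m%:R] = (m ^_ k)%:R :> K.
  elim: k => [|k IH]; first by rewrite big_ord0 ffactn0.
  rewrite big_ord_recr /= IH !hornerE ffactnSr natrM.
  have [km|mk] := leqP k m; first by rewrite natrB.
  by rewrite ffact_small // !mul0r.
rewrite -bin_ffact natrM mulrC mulfK // pnatr_eq0 -lt0n; exact: fact_gt0.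
Qed.

(** The binomial series of (1 + N)^t, which joins 1 to a unipotent element without a logarithm. *)
Definition unipmx N : 'M[{poly K}]_n.+1 :=
  \sum_(k < n.+1) binp k *: map_mx polyC (N ^+ k).

Lemma unipmxE N (m : nat) : N ^+ n.+1 = 0 -> ev_mx (unipmx N) m%:R = (1 + N) ^+ m.
Proof.
move=> nilN; transitivity (\sum_(k < n.+1) N ^+ k *+ 'C(m, k)).
  apply/matrixP=> i j; rewrite mxE /unipmx !summxE -[LHS]/(horner_eval _ _) rmorph_sum.
  apply: eq_bigr => k _; rewrite !mxE /= /horner_eval hornerM hornerC binpE.
  by rewrite mulmxnE mulr_natl.
rewrite exprDn_comm; last exact: commr_sym (commr1 _).
have N0 k : (n < k)%N -> N ^+ k = 0.
  by move=> nk; rewrite -(subnK nk) exprD nilN mulr0.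
(* Both sums are extended to a common length: powers of [N] vanish beyond [n], binomial coefficients
   beyond [m]. *)
transitivity (\sum_(k < m.+1 + n.+1) N ^+ k *+ 'C(m, k)).
  rewrite addnC big_split_ord /= [X in _ + X]big1 ?addr0 // => k _.
  by rewrite N0 ?mul0rn //= addSn ltnS leq_addr.
rewrite big_split_ord /= [X in _ + X]big1 ?addr0 => [|k _].
  by apply: eq_bigr => k _; rewrite expr1n mul1r.
by rewrite bin_small ?mulr0n //= addSn ltnS leq_addr.
Qed.

(** U(t + m) = U(t) (1 + N)^m holds for natural t, hence identically in t. Its derivative at t = 0
    gives U'(m) = U'(0) U(m) for every natural m, hence the differential equation. *)
Lemma unipmx_flow N : N ^+ n.+1 = 0 ->
  flow (ev_mx (map_mx (@deriv K) (unipmx N)) 0) (unipmx N).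
Proof.
move=> nilN; set U := unipmx N; set X := ev_mx _ _.
have shift (m : nat) : map_mx (fun p => p \Po ('X + m%:R%:P)) U
    = U *m map_mx polyC ((1 + N) ^+ m).
  apply/matrixP=> i j; apply: poly_eq_nat => k.
  transitivity (ev_mx U (k%:R + m%:R) i j).
    by rewrite !mxE horner_comp !hornerE.
  transitivity ((ev_mx U k%:R *m (1 + N) ^+ m) i j).
    rewrite -natrD !unipmxE // exprD //.
  rewrite !mxE -[RHS]/(horner_eval _ _) rmorph_sum; apply: eq_bigr => l _.
  by rewrite !mxE /= /horner_eval hornerM hornerC.
split; last by rewrite (unipmxE 0) // expr0.
apply/matrixP=> i j; apply: poly_eq_nat => m.
transitivity ((X *m (1 + N) ^+ m) i j); last first.
  rewrite -unipmxE // [LHS]mxE [X in X.[_]]mxE -[RHS]/(horner_eval _ _) rmorph_sum.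
  by apply: eq_bigr => l _; rewrite !mxE /= /horner_eval hornerM hornerC.
have := congr1 (fun V : 'M[{poly K}]_n.+1 => ((V i j)^`()).[0]) (shift m).
rewrite !mxE deriv_comp derivD derivX derivC addr0 mulr1 horner_comp !hornerE.
move=> ->; rewrite raddf_sum -[LHS]/(horner_eval _ _) rmorph_sum.
by apply: eq_bigr => l _; rewrite !mxE /= derivM derivC mulr0 addr0 /horner_eval !hornerE.
Qed.

End Flows.

(** * The unipotent radical *)

Section Nilpotent.
Variables (n : nat) (K : numClosedFieldType).
Implicit Types A f h u : 'M[K]_n.+1.

Lemma nilpotent_char_poly A k : A ^+ k = 0 -> char_poly A = 'X^(n.+1).
Proof.
move=> nilA; have [s] := closed_field_poly_normal (char_poly A).
rewrite (monicP (char_poly_monic A)) scale1r => defA.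
have s0 : s = nseq (size s) 0.
  apply/all_pred1P/allP => a as_; have : eigenvalue A a.
    by rewrite eigenvalue_root_char defA root_prod_XsubC.
  case/eigenvalueP => v vA v0; have vAk m : v *m A ^+ m = a ^+ m *: v.
    elim: m => [|m IH]; first by rewrite !expr0 mulmx1 scale1r.
    by rewrite exprSr mulmxA IH -scalemxAl vA scalerA -exprSr.
  have /eqP := vAk k; rewrite nilA mulmx0 eq_sym scaler_eq0 (negPf v0) orbF.
  by rewrite expf_eq0 => /andP[_ /eqP ->]; rewrite /= eqxx.
have := size_char_poly A; rewrite defA s0 big_nseq subr0 -Monoid.iteropE.
by rewrite -/('X ^+ _) size_polyXn => -[->].
Qed.

Lemma nilpotent_exp A k : A ^+ k = 0 -> A ^+ n.+1 = 0.
Proof.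
move=> nilA; have := Cayley_Hamilton A.
by rewrite (nilpotent_char_poly nilA) rmorphXn /= horner_mx_X.
Qed.

(** The characteristic polynomial of [1 - u] is a power of the variable; its value at 1 is 1, and
    also the determinant of 1 - (1 - u). *)
Lemma unipotent_det u : (u - 1) ^+ n.+1 = 0 -> \det u = 1.
Proof.
move=> nilu; have := @nilpotent_char_poly (1 - u) n.+1.
rewrite -opprB exprNn nilu mulr0 => /(_ erefl).
move=> /(congr1 (fun p => p.[1])); rewrite hornerXn expr1n /char_poly => <-.
rewrite -[RHS]/(horner_eval 1 _) -det_map_mx; congr (\det _).
apply/matrixP=> i j; rewrite !mxE /= /horner_eval !hornerE.
by case: eqP => _; rewrite ?mulr1n ?mulr0n ?hornerX ?horner0; ring.
Qed.

(** A nonzero power f^k is an eigenvector of ad h with eigenvalue k c. These values are distinct in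
    characteristic 0, and ad h, here the matrix [G], has finitely many eigenvalues. *)
Lemma weight_nilpotent h f (c : K) :
  c != 0 -> h *m f - f *m h = c *: f -> f ^+ n.+1 = 0.
Proof.
move=> c0 hf.
have hfk k : h *m f ^+ k - f ^+ k *m h = (k%:R * c) *: f ^+ k.
  elim: k => [|k IH]; first by rewrite expr0 mulmx1 mul1mx subrr mul0r scale0r.
  rewrite exprS -[f * _]/(f *m _) -natr1 mulrDl scalerDl mul1r.
  have -> : c *: (f *m f ^+ k) = (h *m f - f *m h) *m f ^+ k.
    by rewrite hf scalemxAl.
  have -> : (k%:R * c) *: (f *m f ^+ k) = f *m (h *m f ^+ k - f ^+ k *m h).
    by rewrite IH -scalemxAr.
  by rewrite mulmxBl mulmxBr !mulmxA [RHS]addrC addrA subrK.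
pose G := lin_mx (mulmx h) - lin_mx (mulmxr h).
have vG k : mxvec (f ^+ k) *m G = (k%:R * c) *: mxvec (f ^+ k).
  by rewrite mulmxBr !mul_vec_lin /= -linearB /= hfk linearZ.
have [[k nilf] | nn] := pselect (exists k, f ^+ k = 0); first exact: nilpotent_exp nilf.
have nz : char_poly G != 0 by rewrite monic_neq0 // char_poly_monic.
have := max_poly_roots nz (rs := [seq m%:R * c | m <- iota 0 (size (char_poly G))]).
rewrite size_map size_iota ltnn => H; suff: false by [].
apply: H; last first.
  rewrite map_inj_uniq ?iota_uniq // => a b /(mulIf c0) /eqP.
  by rewrite eqr_nat => /eqP.
apply/allP => _ /mapP[m _ ->]; rewrite -eigenvalue_root_char.
apply/eigenvalueP; exists (mxvec (f ^+ m)); first exact: vG.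
by rewrite mxvec_eq0; apply/eqP => fm; apply: nn; exists m.
Qed.

End Nilpotent.

Section UnipotentRadical.
Variables (R : realType) (n : nat) (I : finType) (D : pinned_group R n I).
Local Notation C := R[i].
Local Notation M := 'M[C]_n.+1.
Local Notation MP := {mpoly C[n.+1 * n.+1]}.
Local Notation Um := (pgUm D).
Local Notation f := (chev_f D).
Implicit Types (X u v g : M) (P Q : MP).

Lemma chev_f_nilpotent k : f k ^+ n.+1 = 0.
Proof.
have [_ _ hf] := pg_f D k.
have Th : Lie (pgT D) (chev_h D k).
  apply/pg_gen_T; exists (fun j => (j == k)%:R).
  rewrite (bigD1 k) //= eqxx scale1r big1 ?addr0 // => j /negPf ->.
  by rewrite scale0r.
apply: (@weight_nilpotent _ _ (chev_h D k) _ (- 2%:R)).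
  by rewrite oppr_eq0 pnatr_eq0.
by have := hf _ Th; rewrite /brk pg_cartan pg_cartan_diag => ->.
Qed.

Lemma Um_group : subgroup Um.
Proof. by have [[[]]] := pg_radical_opp D. Qed.

Lemma Um1 : Um 1. Proof. by have [] := Um_group. Qed.

Lemma UmM u v : Um u -> Um v -> Um (u * v).
Proof. by have [_ _ H _] := Um_group; exact: H. Qed.

Lemma Um_unipotent u : Um u -> (u - 1) ^+ n.+1 = 0.
Proof. by have [[_ _ H _] _] := pg_radical_opp D; exact: H. Qed.

Definition vanishing P : Prop := forall g, Um g -> mxev idfun g P = 0.

Lemma vanishing_Um g : g \is a GRing.unit ->
  (forall P, vanishing P -> mxev idfun g P = 0) -> Um g.
Proof.
have [[[_ [S US]] _ _ _] _] := pg_radical_opp D.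
move=> gu gP; apply/US; split=> // P SP; apply: gP => h /US[_]; exact.
Qed.

(** The inner [mxev] is the right translate x |-> P(x g). Since [lderiv] differentiates on the left,
    it commutes with right translation; values at [g] are thus reduced to values at 1, where [Lie]
    is defined. *)
Lemma lderiv_translate (X g : M) P :
  mxev idfun 1 (lderiv X
    (mxev (@mpolyC _ _) (generic_mx n C *m map_mx (@mpolyC _ _) g) P))
  = mxev idfun g (lderiv X P).
Proof.
rewrite (mxev_lderiv (X := X)); last 4 first.
- exact: lderivD.
- exact: lderivM.
- exact: lderivC.
- apply/matrixP=> i j; rewrite [LHS]mxE [RHS]mxE [X in lderiv _ X]mxE.
  rewrite (big_morph (lderiv X) (lderivD X) (lderiv0 X)).
  transitivity (\sum_l \sum_m (X i m)%:MP * 'X_(mxvec_index m l) * (g l j)%:MP : MP).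
    apply: eq_bigr => l _; rewrite generic_mxE [map_mx _ _ _ _]mxE.
    by rewrite lderivM lderivC mulr0 addr0 lderivU mulr_suml.
  rewrite exchange_big; apply: eq_bigr => m _ /=; rewrite [map_mx _ _ _ _]mxE.
  rewrite [X in _ = _ * X]mxE mulr_sumr; apply: eq_bigr => l _.
  by rewrite generic_mxE [map_mx _ _ _ _]mxE mulrA.
rewrite -[LHS]/(meval (fun k => mxvec 1 0 k) _) mxev_rmorph.
rewrite /mxev; apply: eq_bigr => m _ /=; rewrite mevalC; congr (_ * _).
apply: eq_bigr => k _; congr (_ ^+ _).
case/mxvec_indexP: k => i j; rewrite !mxvecE mxE [(_ *m _) i j]mxE.
rewrite rmorph_sum (bigD1 i) //= big1 => [|l li].
  by rewrite addr0 generic_mxE mxE rmorphM /= mevalXU mevalC mxvecE mxE eqxx mul1r.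
rewrite generic_mxE mxE rmorphM /= mevalXU mevalC mxvecE mxE.
by rewrite eq_sym (negPf li) mul0r.
Qed.

Lemma vanishing_lderiv X P : Lie Um X -> vanishing P -> vanishing (lderiv X P).
Proof.
move=> LX vP g Ug; rewrite -lderiv_translate lderiv_ev mulmx1; apply: LX => h Uh.
rewrite -[LHS]/(meval (fun k => mxvec h 0 k) _) mxev_rmorph.
have := vP _ (UmM Uh Ug); rewrite /mxev => <-; apply: eq_bigr => m _ /=.
rewrite mevalC; congr (_ * _); apply: eq_bigr => k _; congr (_ ^+ _).
case/mxvec_indexP: k => i j; rewrite !mxvecE !mxE rmorph_sum.
by apply: eq_bigr => l _; rewrite generic_mxE mxE rmorphM /= mevalXU mevalC mxvecE.
Qed.

Lemma Lie_chev_f k : Lie Um (f k).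
Proof. by rewrite pg_gen_Um => L _; apply; exists k. Qed.

Lemma mexpE X (t : C) : mexp (t *: X) = expmx idfun X t.
Proof.
apply: eq_bigr => k _; rewrite exprZn scalerA /=; congr (_ *: _).
by apply/matrixP=> i j; rewrite mxE.
Qed.

Lemma ev_mx_expmx X (t : C) : ev_mx (expmx polyC X 'X) t = mexp (t *: X).
Proof.
rewrite mexpE -[t in RHS](hornerX t) -[_.[_]]/(horner_eval t 'X).
apply: (@expmx_rmorph _ _ _ _ polyC (horner_eval t) idfun X 'X) => c.
by rewrite /= /horner_eval hornerC.
Qed.

Lemma expmx_unipotent X (t : C) : X ^+ n.+1 = 0 ->
  (mexp (t *: X) - 1) ^+ n.+1 = 0.
Proof.
move=> nilX; rewrite mexpE /expmx big_ord_recl /= invr1 expr0 mul1r scale1r expr0.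
rewrite map_mx1 addrC addKr.
set Y := \sum_(k < n) _.
have [Z YX XZ] : exists2 Z, Y = X * Z & GRing.comm X Z.
  exists (\sum_(k < n) ((lift ord0 k)`!%:R^-1 * t ^+ (lift ord0 k)) *: X ^+ k).
    rewrite mulr_sumr; apply: eq_bigr => k _; rewrite -scalerAr -exprS.
    by congr (_ *: _); apply/matrixP=> i j; rewrite mxE.
  rewrite /GRing.comm mulr_sumr mulr_suml; apply: eq_bigr => k _.
  by rewrite -scalerAr -scalerAl -exprS -exprSr.
by rewrite YX exprMn_comm // nilX mul0r.
Qed.

Lemma unipotent_unit (u : M) : (u - 1) ^+ n.+1 = 0 -> u \is a GRing.unit.
Proof. by move=> nilu; rewrite unitmxE unipotent_det ?unitr1. Qed.

(** The ideal of U^- is stable under [lderiv (f k)], so its members vanish along the whole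
    one-parameter group. *)
Lemma Um_mexp k (t : C) : Um (mexp (t *: f k)).
Proof.
have nf := chev_f_nilpotent k.
apply: vanishing_Um => [|P vP]; first exact/unipotent_unit/expmx_unipotent.
rewrite -ev_mx_expmx; apply: (flow_vanish (J := vanishing)) vP _.
- exact: expmx_flow.
- by move=> Q; apply: vanishing_lderiv; exact: Lie_chev_f.
- by move=> Q; apply; exact: Um1.
Qed.

Lemma Um_exp_path r (j : r.-tuple I) (t : 'I_r -> C) : Um (exp_path D j t).
Proof.
apply: big_ind => [|u v|k _]; [exact: Um1 | exact: UmM | exact: Um_mexp].
Qed.

Lemma UmX u k : Um u -> Um (u ^+ k).
Proof.
move=> Uu; elim: k => [|k IH]; first by rewrite expr0; exact: Um1.
by rewrite exprS; exact: UmM.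
Qed.

(* The polynomial t |-> P(u^t) vanishes at every natural number, hence
   identically; its derivative at 0 is the differential of P at 1 along log u. *)
Lemma Lie_log u : Um u ->
  Lie Um (ev_mx (map_mx (@deriv C) (unipmx (u - 1))) 0).
Proof.
move=> Uu P vP; set X := ev_mx _ _.
have [dU U0] := unipmx_flow (Um_unipotent Uu).
have along0 : along (unipmx (u - 1)) P = 0.
  apply: poly_eq_nat => m; rewrite horner0 along_ev unipmxE ?Um_unipotent //.
  by rewrite addrC subrK; apply: vP; exact: UmX.
have := along_deriv P dU; rewrite along0 deriv0 => /(congr1 (horner^~ 0)).
by rewrite horner0 along_ev U0 lderiv_ev mulmx1 => /esym.
Qed.

(* <phi, f_{j_1} ... f_{j_m}> for the function phi with polynomial P. *)
Definition wpair P (j : seq I) : C :=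
  mxev idfun 1 (foldl (fun Q k => lderiv (f k) Q) P j).

Lemma wpair_cons P k j : wpair P (k :: j) = wpair (lderiv (f k) P) j.
Proof. by []. Qed.

Lemma wpairD P Q j : wpair (P + Q) j = wpair P j + wpair Q j.
Proof.
elim: j P Q => [|k j IH] P Q; first by rewrite /wpair /mxev /= mmapD.
by rewrite !wpair_cons lderivD IH.
Qed.

Lemma wpairZ c P j : wpair (c *: P) j = c * wpair P j.
Proof.
elim: j P => [|k j IH] P; first by rewrite /wpair /mxev /= mmapZ.
by rewrite !wpair_cons lderivZ IH.
Qed.

Lemma wpairN P j : wpair (- P) j = - wpair P j.
Proof. by rewrite -[- P]scaleN1r wpairZ mulN1r. Qed.

(* The X with L_X J <= J, where J consists of the P orthogonal to all words,
   form a Lie algebra containing the f_i, hence Lie U^-; integrating along u^t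
   shows that J vanishes on U^-. *)
Lemma wpair_nondegenerate P : (forall j, wpair P j = 0) -> vanishing P.
Proof.
move=> P0 u Uu; pose J Q := forall j, wpair Q j = 0.
have JD P1 P2 : J P1 -> J P2 -> J (P1 + P2).
  by move=> J1 J2 j; rewrite wpairD J1 J2 addr0.
have JZ c P1 : J P1 -> J (c *: P1) by move=> J1 j; rewrite wpairZ J1 mulr0.
have LJ : Lie_subalgebra [set X | forall Q, J Q -> J (lderiv X Q)].
  split=> [Q _|X Y JX JY Q JQ|c X JX Q JQ|X Y JX JY Q JQ].
  - by rewrite lderiv_linear0 -(scale0r P); apply: (JZ).
  - by rewrite lderiv_addl; apply: JD; [exact: JX | exact: JY].
  - by rewrite lderiv_scalel; apply: (JZ); exact: JX.
  - rewrite /brk lderiv_brk -scaleN1r; apply: (JD); first exact/JY/JX.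
    by apply: (JZ); exact/JX/JY.
have fJ : range f `<=` [set X | forall Q, J Q -> J (lderiv X Q)].
  by move=> _ [k _ <-] Q JQ j; rewrite -wpair_cons.
have LX := Lie_log Uu; rewrite pg_gen_Um in LX.
have := flow_vanish (J := J) (unipmx_flow (Um_unipotent Uu)) (LX _ LJ fJ) _ P0 1%:R.
rewrite unipmxE ?Um_unipotent // expr1 addrC subrK; apply.
by move=> Q /(_ [::]).
Qed.

End UnipotentRadical.

(** * Coordinates on U^- *)

Section MpolyExtra.
Variables (r : nat) (K : comNzRingType).
Implicit Types (p : {mpoly K[r]}).

Lemma meval_at0 p : p.@[fun=> 0] = p@_0%MM.
Proof.
elim/mpoly_ring_ind: p => [c|k|p q Hp Hq|p q Hp Hq].
- by rewrite mevalC mcoeffC eqxx mulr1.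
- by rewrite mevalXU mcoeffX mnm1_eq0.
- by rewrite mevalD mcoeffD Hp Hq.
- by rewrite mevalM Hp Hq rmorphM.
Qed.

Definition kill (l : 'I_r) p : {mpoly K[r]} :=
  mmap (@mpolyC _ K) (fun k => if k == l then 0 else 'X_k) p.

Lemma mcoeff_kill l p (a : 'X_{1..r}) : a l = 0%N -> (kill l p)@_a = p@_a.
Proof.
move=> al; rewrite [p in RHS]mpolyE /kill /mmap !raddf_sum /=.
apply: eq_bigr => m _; rewrite mcoeffCM mcoeffZ mcoeffX; congr (_ * _).
have [ml | ml] := eqVneq (m l) 0%N.
  suff -> : mmap1 (fun k => if k == l then 0 else 'X_k) m = 'X_[m] :> {mpoly K[r]}.
    by rewrite mcoeffX.
  rewrite mpolyXE_id; apply: eq_bigr => k _.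
  by case: eqP => [->|//]; rewrite ml !expr0.
rewrite /mmap1 (bigD1 l) //= eqxx expr0n (negPf ml) mul0r mcoeff0.
by case: eqP => // ma; rewrite ma al in ml.
Qed.

End MpolyExtra.

(** Partial derivatives of a polynomial vanishing everywhere vanish everywhere, and their values at
    0 are the coefficients up to factorials. *)
Lemma meval_eq0 r (K : numClosedFieldType) (p : {mpoly K[r]}) :
  (forall t, p.@[t] = 0) -> p = 0.
Proof.
have step (q : {mpoly K[r]}) k :
    (forall t, q.@[t] = 0) -> forall t, (q^`M(k)).@[t] = 0.
  (* [h] restricts [q] to the line through [t] in direction [k]. *)
  move=> q0 t; pose h l : {poly K} := if l == k then 'X else (t l)%:P.
  have ev (q' : {mpoly K[r]}) s : (mmap polyC h q').[s] =
      q'.@[fun l => if l == k then s else t l].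
    rewrite -[LHS]/(horner_eval s _) /meval /mmap rmorph_sum; apply: eq_bigr => m _.
    rewrite rmorphM rmorph_prod /= /horner_eval hornerC; congr (_ * _).
    by apply: eq_bigr => l _; rewrite horner_exp /h; case: eqP => _; rewrite ?hornerX ?hornerC.
  have h0 : mmap polyC h q = 0.
    by apply: poly_eq_nat => m; rewrite ev q0 horner0.
  have := @derivation_mmap _ _ _ polyC h (@deriv K) (@derivD K) (@derivM K) (@derivC K) q.
  rewrite h0 deriv0 (bigD1 k) //= big1 => [|l lk]; last first.
    by rewrite /h (negPf lk) derivC mulr0.
  rewrite /h eqxx derivX mulr1 addr0 -/h => /(congr1 (horner^~ (t k))).
  rewrite horner0 ev => /esym <-; apply: meval_eq => l.
  by case: eqP => // ->.
move=> p0; apply/mpolyP => m; rewrite mcoeff0.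
have q0 : forall t, (p^`M[m]).@[t] = 0.
  rewrite mderivm_foldr; elim: (flatten _) => [|k s IH] //=.
  exact: step.
have := q0 (fun=> 0); rewrite meval_at0 mcoeff_mderivm addm0 => /eqP.
rewrite mulrn_eq0 => /orP[|/eqP //]; rewrite eqn0Ngt prodn_gt0 // => k.
by rewrite ffact_gt0.
Qed.

(** The monomial f_{j_1}^{a_1} ... f_{j_m}^{a_m}, spelled letter by letter. *)
Fixpoint word (I : Type) (j : seq I) (a : seq nat) : seq I :=
  if (j, a) is (k :: j', e :: a') then nseq e k ++ word j' a' else [::].

Lemma word_ones (I : Type) (j : seq I) : word j (nseq (size j) 1%N) = j.
Proof. by elim: j => //= k j ->. Qed.

Lemma word_zeros (I : Type) (j : seq I) a :
  (forall k, (k < size j)%N -> nth 0%N a k = 0%N) -> word j a = [::].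
Proof.
elim: j a => [|k j IH] [|e a] //= a0.
have /= -> := a0 0%N isT; rewrite IH // => l lj; exact: (a0 l.+1).
Qed.

Lemma word_lead (I : Type) (x : I) (j : seq I) a a' l :
  size a = size j -> size a' = size j -> (l < size j)%N ->
  (forall k, (k < l)%N -> nth 0%N a k = 0%N) ->
  nth 0%N a l = (nth 0%N a' l).+1 ->
  (forall k, k != l -> nth 0%N a k = nth 0%N a' k) ->
  word j a = nth x j l :: word j a'.
Proof.
elim: j a a' l => [|y j IH] [|e a] [|e' a'] [|l] //= [sa] [sa'] lj a0 al ak.
  rewrite al /=; congr (_ :: (_ ++ word _ _)).
  apply: (@eq_from_nth _ 0%N) => [|k _]; first by rewrite sa sa'.
  exact: (ak k.+1).
have /= e0 := a0 0%N isT; have /= <- := ak 0%N isT; rewrite e0; apply: IH => // [k kl|k kl].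
  exact: (a0 k.+1).
exact: (ak k.+1).
Qed.

Section Pullback.
Variables (R : realType) (n : nat) (I : finType) (D : pinned_group R n I).
Local Notation C := R[i].
Local Notation M := 'M[C]_n.+1.
Local Notation MP := {mpoly C[n.+1 * n.+1]}.
Local Notation Um := (pgUm D).
Local Notation f := (chev_f D).
Implicit Types (X u v g : M) (P Q : MP) (phi : M -> C).

(** * Coefficients of a function along a path *)

Section Path.
Variables (r : nat) (j : r.-tuple I).
Local Notation A := {mpoly C[r]}.

Definition xexp (k : 'I_r) : 'M[A]_n.+1 := expmx (@mpolyC r C) (f (tnth j k)) 'X_k.

(* The factors 0, ..., l - 1 of the path are dropped. *)
Definition path_from (l : nat) : 'M[A]_n.+1 := \prod_(k <- drop l (enum 'I_r)) xexp k.

Definition path_poly (l : nat) P : A := mxev (@mpolyC r C) (path_from l) P.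

Lemma path_from_rec (l : 'I_r) : path_from l = xexp l *m path_from l.+1.
Proof.
rewrite /path_from (drop_nth l) ?size_enum_ord // big_cons.
by rewrite nth_ord_enum.
Qed.

Lemma map_mx_derivM (B : comNzRingType) (d : B -> B) (U V : 'M[B]_n.+1) :
  (forall x y, d (x + y) = d x + d y) ->
  (forall x y, d (x * y) = d x * y + x * d y) ->
  map_mx d (U *m V) = map_mx d U *m V + U *m map_mx d V.
Proof.
move=> dD dM; have d0 : d 0 = 0.
  by apply: (addrI (d 0)); rewrite -dD !addr0.
apply/matrixP=> a b; rewrite !mxE (big_morph d dD d0) -big_split.
by apply: eq_bigr => c _ /=; rewrite !mxE dM.
Qed.

Lemma deriv_path_after (l : 'I_r) : map_mx (mderiv l) (path_from l.+1) = 0.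
Proof.
have late : forall k : 'I_r, k \in drop l.+1 (enum 'I_r) -> (l < k)%N.
  move=> k /(nthP l)[m]; rewrite size_drop size_enum_ord => lm <-.
  rewrite nth_drop -[X in (_ < X)%N]/(val _) -(nth_map l 0%N); last first.
    by rewrite size_enum_ord -ltn_subRL.
  rewrite val_enum_ord nth_iota; last by rewrite -ltn_subRL.
  by rewrite add0n addSn ltnS leq_addr.
rewrite /path_from; elim: (drop _ _) late => [|k s IH] late.
  rewrite big_nil; apply/matrixP=> a b; rewrite !mxE.
  by case: eqP => _; rewrite ?mulr1n ?mulr0n ?mderiv0 // -mpolyC1 mderivC.
rewrite big_cons map_mx_derivM; [|exact: mderivD|exact: mderivM].
rewrite IH ?mulmx0 ?addr0 => [|m ms]; last by apply: late; rewrite inE ms orbT.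
suff -> : map_mx (mderiv l) (xexp k) = 0 by rewrite mul0mx.
have lk : l != k by rewrite neq_ltn late ?inE ?eqxx.
apply/matrixP=> a b; rewrite !mxE summxE raddf_sum big1 // => m _ /=.
rewrite !mxE mderivM mderivC mulr0 addr0 mderiv_mulC.
have -> : ('X_k ^+ m : A)^`M(l) = 0.
  elim: (nat_of_ord m) => [|e IHe]; first by rewrite expr0 -mpolyC1 mderivC.
  by rewrite exprS mderivM mderivU (negPf lk) mul0r add0r IHe mulr0.
by rewrite mulr0 mul0r.
Qed.

(** Once the factors before [l] are dropped, the variable [l] occurs in the leftmost factor only,
    and differentiating that factor multiplies the path by f on the left. *)
Lemma deriv_path_poly (l : 'I_r) P :
  (path_poly l P)^`M(l) = path_poly l (lderiv (f (tnth j l)) P).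
Proof.
apply: (mxev_lderiv (d := mderiv l)).
- exact: mderivD.
- exact: mderivM.
- exact: mderivC.
rewrite path_from_rec map_mx_derivM; [|exact: mderivD|exact: mderivM].
rewrite deriv_path_after mulmx0 addr0 mulmxA; congr (_ *m _).
apply: expmx_deriv.
- exact: chev_f_nilpotent.
- exact: mderivD.
- exact: mderivM.
- exact: mderivC.
- by rewrite mderivU eqxx.
Qed.

Lemma expmx_0 (B : comNzRingType) (g : {rmorphism C -> B}) X : expmx g X 0 = 1.
Proof.
rewrite /expmx big_ord_recl big1 => [|k _].
  by rewrite addr0 /= invr1 rmorph1 expr0 mulr1 scale1r expr0 map_mx1.
by rewrite expr0n mulr0 scale0r.
Qed.

Lemma kill_path (l : 'I_r) P : kill l (path_poly l P) = kill l (path_poly l.+1 P).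
Proof.
pose g : {rmorphism A -> A} := mmap (@mpolyC r C) (fun k => if k == l then 0 else 'X_k).
have gev l' : kill l (path_poly l' P) = mxev (g \o @mpolyC r C) (map_mx g (path_from l')) P.
  exact: (mxev_rmorph (@mpolyC r C) g).
suff gE : map_mx g (path_from l) = map_mx g (path_from l.+1).
  exact: (etrans (gev l) (etrans (congr1 (fun U => mxev (g \o @mpolyC r C) U P) gE)
    (esym (gev l.+1)))).
have -> : path_from l = xexp l *m path_from l.+1 by exact: path_from_rec.
apply: etrans (map_mxM g (xexp l) (path_from l.+1)) _.
suff -> : map_mx g (xexp l) = 1 by exact: mul1mx.
rewrite /xexp (@expmx_rmorph _ _ _ _ _ g (@mpolyC r C)) => [|c].
  by rewrite /g /= mmapX mmap1U eqxx expmx_0.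
by rewrite /g /= mmapC.
Qed.

(** Induction on the number of remaining factors, then on the exponent of the first one. If that
    exponent is 0, setting the variable to 0 removes the factor; otherwise a derivative lowers it
    and consumes one letter. The factorials collect the constants of differentiation. *)
Lemma mcoeff_path_poly l (a : 'X_{1..r}) P : (l <= r)%N ->
  (forall k : 'I_r, (k < l)%N -> a k = 0%N) ->
  (path_poly l P)@_a * (\prod_k (a k)`!)%:R = wpair D P (word j a).
Proof.
move=> lr; have [m ml] : exists m, (l + m)%N = r by exists (r - l)%N; rewrite subnKC.
elim: m l lr ml a P => [|m IHm] l lr ml a P al.
  have lE : l = r by rewrite -ml addn0.
  have a0 : a = 0%MM by apply/mnmP=> k; rewrite mnm0E al // lE ltn_ord.
  rewrite a0 big1 ?mulr1 => [|k _]; last by rewrite mnm0E.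
  rewrite word_zeros => [|k kj]; last first.
    rewrite size_tuple in kj.
    by rewrite -[k]/(val (Ordinal kj)) -mnm_nth mnm0E.
  rewrite /path_poly /path_from drop_oversize ?size_enum_ord -?ml ?addn0 // big_nil.
  rewrite /wpair /= -meval_at0 -[LHS]/(meval _ _) (mxev_rmorph (@mpolyC r C) (meval _)) map_mx1.
  by rewrite /mxev; apply: eq_bigr => m _; rewrite /= mevalC.
have {}lr : (l < r)%N by rewrite -ml addnS ltnS leq_addr.
pose lo := Ordinal lr; rewrite -[l]/(nat_of_ord lo).
have [e] : {e | a lo = e} by exists (a lo).
elim: e a P al => [|e IHe] a P al ae.
  rewrite -(mcoeff_kill _ ae) kill_path (mcoeff_kill _ ae) IHm ?addSn -?addnS // => k.
  rewrite ltnS leq_eqVlt => /orP[/eqP kl|]; last exact: al.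
  by rewrite (_ : k = lo) //; exact: val_inj.
pose a' := (a - U_(lo))%MM.
have aE : a = (a' + U_(lo))%MM.
  by rewrite /a' submK // lep1mP ae.
have a'l : a' lo = e by rewrite /a' mnmBE ae mnm1E eqxx subn1.
have a'k k : k != lo -> a' k = a k.
  by move=> klo; rewrite /a' mnmBE mnm1E eq_sym (negPf klo) subn0.
rewrite (word_lead (tnth j lo) (a' := a') (l := l)) ?size_tuple //.
- rewrite (_ : nth _ _ _ = tnth j lo); last by rewrite [RHS](tnth_nth (tnth j lo)).
  rewrite wpair_cons -IHe //; last first.
    move=> k kl; rewrite a'k ?al //.
    by apply: contraTneq kl => ->; rewrite ltnn.
  rewrite -deriv_path_poly mcoeff_deriv -aE a'l (bigD1 lo) //= [in RHS](bigD1 lo) //=.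
  have -> : (\prod_(k | k != lo) (a k)`! = \prod_(k | k != lo) (a' k)`!)%N.
    by apply: eq_bigr => k klo; rewrite a'k.
  rewrite ae a'l factS !natrM.
  by rewrite !mulrA; congr (_ * _ * _); exact: mulr_natr.
- move=> k kl; have kr := ltn_trans kl lr.
  by rewrite -[k]/(val (Ordinal kr)) -mnm_nth al.
- by rewrite -[l]/(val lo) -!mnm_nth ae a'l.
- move=> k kl; have [kr|rk] := ltnP k r; last by rewrite !nth_default ?size_tuple.
  by rewrite -[k]/(val (Ordinal kr)) -!mnm_nth a'k.
Qed.

Lemma path_poly_ev P t : (path_poly 0 P).@[t] = mxev idfun (exp_path D j t) P.
Proof.
rewrite -[LHS]/(meval t _) (mxev_rmorph (@mpolyC r C) (meval t)).
have -> : map_mx (meval t) (path_from 0) = exp_path D j t.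
  rewrite /path_from drop0 enumT /exp_path.
  rewrite rmorph_prod; apply: eq_bigr => k _ /=.
  rewrite mexpE /xexp (@expmx_rmorph _ _ _ _ _ _ idfun) => [|c] /=.
    by rewrite mevalXU.
  by rewrite mevalC.
by rewrite /mxev; apply: eq_bigr => m _; rewrite /= mevalC.
Qed.

End Path.

Definition represents P phi : Prop := forall g, Um g -> phi g = mxev idfun g P.

(** No denominator survives, because unipotent matrices have determinant 1. *)
Lemma CU_represents phi : CU D phi -> exists P, represents P phi.
Proof.
case=> -[P [k Pk]] _; exists P => g Ug.
rewrite Pk // unipotent_det; [by rewrite expr1n divr1 | exact: (Um_unipotent (D := D))].
Qed.

Definition toCU P : M -> C := restriction Um (fun g => mxev idfun g P).

Lemma toCU_represents P : represents P (toCU P).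
Proof. by move=> g Ug; rewrite /toCU /restriction asboolT. Qed.

Lemma represents_CU P phi :
  represents P phi -> (forall g, ~ Um g -> phi g = 0) -> CU D phi.
Proof.
by move=> Pphi phi0; split=> //; exists P, 0%N => g Ug; rewrite Pphi // expr0 divr1.
Qed.

Lemma CU_toCU P : CU D (toCU P).
Proof.
apply: (represents_CU (toCU_represents P)) => g nUg.
by rewrite /toCU /restriction asboolF.
Qed.

Lemma CU_out phi g : CU D phi -> ~ Um g -> phi g = 0.
Proof. by case=> _; apply. Qed.

Lemma representsD P Q phi psi : represents P phi -> represents Q psi ->
  represents (P + Q) (fun g => phi g + psi g).
Proof. by move=> Pphi Qpsi g Ug; rewrite Pphi // Qpsi // /mxev mmapD. Qed.

Lemma representsM P Q phi psi : represents P phi -> represents Q psi ->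
  represents (P * Q) (fun g => phi g * psi g).
Proof. by move=> Pphi Qpsi g Ug; rewrite Pphi // Qpsi // /mxev rmorphM. Qed.

Lemma representsZ c P phi : represents P phi ->
  represents (c *: P) (fun g => c * phi g).
Proof. by move=> Pphi g Ug; rewrite Pphi // /mxev mmapZ. Qed.

Lemma pullbackE P phi r (j : r.-tuple I) : represents P phi ->
  pullback D j phi = path_poly j 0 P.
Proof.
move=> Pphi; have ev t : (path_poly j 0 P).@[t] = phi (exp_path D j t).
  by rewrite path_poly_ev Pphi //; exact: Um_exp_path.
apply: xget_unique => // q qE; apply/eqP; rewrite -subr_eq0; apply/eqP.
by apply: meval_eq0 => t; rewrite mevalB ev qE subrr.
Qed.

Lemma pullback_coeff P phi r (j : r.-tuple I) (a : 'X_{1..r}) : represents P phi ->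
  (pullback D j phi)@_a * (\prod_k (a k)`!)%:R = wpair D P (word j a).
Proof. by move=> Pphi; rewrite (pullbackE j Pphi) mcoeff_path_poly. Qed.

Lemma pairingE P phi j : represents P phi -> pairing D phi j = wpair D P j.
Proof.
move=> Pphi; rewrite /pairing meval_at0 mcoeff_mderivm.
rewrite big1 => [|k _]; last by rewrite addm0 !mnmE.
rewrite addm0 mulr1n; have := pullback_coeff (in_tuple j) [multinom 1%N | _ < size j] Pphi.
rewrite big1 ?mulr1 => [->|k _]; last by rewrite mnmE.
congr (wpair _ _ _); rewrite -[RHS]word_ones /=; congr word.
by rewrite -[in RHS](size_enum_ord (size j)); elim: (enum _) => //= ? ? ->.
Qed.

Lemma pullback_mcoeff phi r (j : r.-tuple I) (a : 'X_{1..r}) : CU D phi ->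
  ((pullback D j phi)@_a != 0) = (pairing D phi (word j a) != 0).
Proof.
case/CU_represents => P Pphi; rewrite (pairingE _ Pphi) -(pullback_coeff _ _ Pphi).
rewrite mulf_eq0 negb_or pnatr_eq0 -lt0n prodn_gt0 ?andbT // => k.
exact: fact_gt0.
Qed.

Lemma pullback_meval phi r (j : r.-tuple I) t : CU D phi ->
  (pullback D j phi).@[t] = phi (exp_path D j t).
Proof.
case/CU_represents => P Pphi; rewrite (pullbackE _ Pphi) path_poly_ev Pphi //.
exact: Um_exp_path.
Qed.

Lemma CU_D phi psi : CU D phi -> CU D psi -> CU D (fun g => phi g + psi g).
Proof.
move=> cphi cpsi; have [P Pphi] := CU_represents cphi.
have [Q Qpsi] := CU_represents cpsi.
apply: (represents_CU (representsD Pphi Qpsi)) => g nUg.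
by rewrite !(CU_out _ nUg) // addr0.
Qed.

Lemma CU_Z c phi : CU D phi -> CU D (fun g => c * phi g).
Proof.
move=> cphi; have [P Pphi] := CU_represents cphi.
apply: (represents_CU (representsZ c Pphi)) => g nUg.
by rewrite !(CU_out _ nUg) // mulr0.
Qed.

Lemma CU_0 : CU D (fun=> 0).
Proof.
apply: (represents_CU (P := 0)) => // g _.
by rewrite /mxev mmap0.
Qed.

Lemma pairingD phi psi j : CU D phi -> CU D psi ->
  pairing D (fun g => phi g + psi g) j = pairing D phi j + pairing D psi j.
Proof.
case/CU_represents=> P Pphi /CU_represents[Q Qpsi].
by rewrite (pairingE _ (representsD Pphi Qpsi)) wpairD (pairingE _ Pphi) (pairingE _ Qpsi).
Qed.

Lemma pairingZ c phi j : CU D phi ->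
  pairing D (fun g => c * phi g) j = c * pairing D phi j.
Proof.
by case/CU_represents=> P Pphi; rewrite (pairingE _ (representsZ c Pphi)) wpairZ (pairingE _ Pphi).
Qed.

Lemma pairing0 j : pairing D (fun=> 0) j = 0.
Proof.
rewrite -[LHS](_ : pairing D (fun=> 0 * 0) j = _); last by rewrite mulr0.
by rewrite (pairingZ _ _ CU_0) mul0r.
Qed.

Lemma CU_sum m (a : 'I_m -> C) (tau : 'I_m -> M -> C) :
  (forall k, CU D (tau k)) -> CU D (fun g => \sum_k a k * tau k g).
Proof.
elim: m a tau => [|m IH] a tau ctau.
  rewrite (_ : (fun g => _) = (fun=> 0)); first exact: CU_0.
  by apply/funext => g; rewrite big_ord0.
rewrite (_ : (fun g => _) = fun g => a ord0 * tau ord0 g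
   + \sum_k a (lift ord0 k) * tau (lift ord0 k) g); last first.
  by apply/funext => g; rewrite big_ord_recl.
by apply: CU_D; [exact: CU_Z | exact: IH].
Qed.

Lemma pairing_sum m (a : 'I_m -> C) (tau : 'I_m -> M -> C) j :
  (forall k, CU D (tau k)) ->
  pairing D (fun g => \sum_k a k * tau k g) j = \sum_k a k * pairing D (tau k) j.
Proof.
elim: m a tau => [|m IH] a tau ctau.
  rewrite big_ord0 -[RHS](pairing0 j); congr pairing.
  by apply/funext => g; rewrite big_ord0.
rewrite (_ : (fun g => _) = fun g => a ord0 * tau ord0 g
   + \sum_k a (lift ord0 k) * tau (lift ord0 k) g); last first.
  by apply/funext => g; rewrite big_ord_recl.
rewrite pairingD; [|exact: CU_Z | exact: CU_sum].
by rewrite pairingZ // IH // big_ord_recl.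
Qed.

(** Nondegeneracy in terms of functions: identities between functions on U^- may be checked on
    words. *)
Lemma CU_ext phi psi : CU D phi -> CU D psi ->
  (forall j, pairing D phi j = pairing D psi j) -> phi = psi.
Proof.
move=> cphi cpsi E; have [P Pphi] := CU_represents cphi.
have [Q Qpsi] := CU_represents cpsi.
apply/funext => g; have [Ug | nUg] := pselect (Um g); last by rewrite !CU_out.
have := @wpair_nondegenerate _ _ _ D (P + (-1) *: Q) _ g Ug.
rewrite Pphi // Qpsi // {1}/mxev mmapD mmapZ /= mulN1r => /(_ _)/eqP.
rewrite subr_eq0 => H; apply/eqP/H => j.
by rewrite wpairD wpairZ -(pairingE _ Pphi) -(pairingE _ Qpsi) E mulN1r subrr.
Qed.

Lemma actP k phi : CU D phi -> CU D (act D k phi) /\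
  forall j, pairing D (act D k phi) j = - pairing D phi (k :: j).
Proof.
case/CU_represents => P Pphi; pose S : set (M -> C) :=
  [set psi | CU D psi /\ forall j, pairing D psi j = - pairing D phi (k :: j)].
suff : exists psi, S psi by move/(xgetPex (fun=> 0)).
exists (toCU ((-1) *: lderiv (f k) P)); split; first exact: CU_toCU.
move=> j; rewrite (pairingE _ (toCU_represents _)) wpairZ mulN1r -wpair_cons.
by rewrite (pairingE _ Pphi).
Qed.

Lemma CU_act k phi : CU D phi -> CU D (act D k phi).
Proof. by move=> cphi; have [] := actP k cphi. Qed.

Lemma pairing_act k phi j : CU D phi ->
  pairing D (act D k phi) j = - pairing D phi (k :: j).
Proof. by move=> cphi; have [_ ->] := actP k cphi. Qed.

Lemma pairingM_nil phi psi : CU D phi -> CU D psi ->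
  pairing D (fun g => phi g * psi g) [::] = pairing D phi [::] * pairing D psi [::].
Proof.
case/CU_represents=> P Pphi /CU_represents[Q Qpsi].
rewrite (pairingE _ (representsM Pphi Qpsi)) (pairingE _ Pphi) (pairingE _ Qpsi).
by rewrite /wpair /= /mxev rmorphM.
Qed.

(** The Leibniz rule for f_l; the sign is the one built into [act]. *)
Lemma pairingM_cons phi psi l j : CU D phi -> CU D psi ->
  pairing D (fun g => phi g * psi g) (l :: j)
  = - (pairing D (fun g => act D l phi g * psi g) j
       + pairing D (fun g => phi g * act D l psi g) j).
Proof.
move=> cphi cpsi; have [P Pphi] := CU_represents cphi.
have [Q Qpsi] := CU_represents cpsi.
have rep P' phi' : represents P' phi' -> CU D phi' ->
    represents (- lderiv (f l) P') (act D l phi').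
  move=> rP cP; suff -> : act D l phi' = toCU (- lderiv (f l) P').
    exact: toCU_represents.
  apply: CU_ext => [||j']; [exact: CU_act | exact: CU_toCU |].
  rewrite pairing_act // (pairingE _ (toCU_represents _)) wpairN.
  by rewrite -wpair_cons (pairingE _ rP).
rewrite (pairingE _ (representsM Pphi Qpsi)) wpair_cons lderivM wpairD.
rewrite (pairingE _ (representsM (rep _ _ Pphi cphi) Qpsi)).
rewrite (pairingE _ (representsM Pphi (rep _ _ Qpsi cpsi))).
rewrite mulNr mulrN !wpairN.
by rewrite opprD !opprK.
Qed.

(** * Multiplication by a function dual to a single letter *)

Section Letter.
Variables (k : I) (x : M -> C).
Hypotheses (cx : CU D x) (xk : forall j, j <> [:: k] -> pairing D x j = 0).

Lemma act_letter l : act D l x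
  = (fun g => (if l == k then - pairing D x [:: k] else 0) * toCU 1 g).
Proof.
apply: CU_ext => [||j]; [exact: CU_act | exact/CU_Z/CU_toCU |].
rewrite pairing_act // pairingZ; last exact: CU_toCU.
rewrite (pairingE j (toCU_represents 1)).
case: j => [|m j].
  rewrite /wpair /= /mxev rmorph1 mulr1; case: eqP => [->//|lk].
  by rewrite xk ?oppr0 // => -[].
rewrite xk ?oppr0 // wpair_cons -mpolyC1 lderivC.
rewrite -[X in wpair _ X](scale0r (0 : MP)) wpairZ.
by rewrite mul0r mulr0.
Qed.

Lemma pairing_letter_nil phi : CU D phi ->
  pairing D (fun g => x g * phi g) [::] = 0.
Proof. by move=> cphi; rewrite pairingM_nil // xk // mul0r. Qed.

Lemma pairing_letter_cons phi l j : CU D phi ->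
  pairing D (fun g => x g * phi g) (l :: j)
  = (if l == k then pairing D x [:: k] else 0) * pairing D phi j
    - pairing D (fun g => x g * act D l phi g) j.
Proof.
move=> cphi; rewrite pairingM_cons // act_letter opprD; congr (_ + _).
set c := if l == k then - _ else 0.
rewrite -[LHS]mulN1r -[X in _ * X](_ : pairing D (fun g => c * phi g) j = _).
  rewrite pairingZ // mulrA mulN1r /c; case: ifP => _; by rewrite ?opprK ?oppr0.
congr pairing; apply/funext => g.
have [Ug|nUg] := pselect (Um g); last by rewrite (CU_out cphi nUg) !mulr0.
by rewrite toCU_represents // /mxev rmorph1 mulr1.
Qed.

(** f_k^m kills [phi], while f_k . x is constant. In the Leibniz expansion exactly one of the [m]
    letters must therefore hit [x], and each choice contributes the same term. *)
Lemma pairing_letter_nseq phi m j : CU D phi ->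
  (forall j, pairing D phi (nseq m k ++ j) = 0) ->
  pairing D (fun g => x g * phi g) (nseq m k ++ j)
  = m%:R * pairing D x [:: k] * pairing D phi (nseq m.-1 k ++ j).
Proof.
elim: m phi => [|m IH] phi cphi phi0.
  rewrite (_ : phi = fun=> 0); last first.
    by apply: CU_ext => [//||j']; [exact: CU_0 | rewrite pairing0; exact: phi0].
  rewrite !mul0r (_ : (fun g => _) = fun=> 0) ?pairing0 //.
  by apply/funext => g; rewrite mulr0.
rewrite /= pairing_letter_cons // eqxx IH; [|exact: CU_act|]; last first.
  by move=> j'; rewrite pairing_act // (phi0 j') oppr0.
rewrite pairing_act // mulrN opprK.
case: m {IH phi0} => [|m] /=; first by rewrite !mul0r addr0 mul1r.
by rewrite -[m.+2%:R]natr1 !mulrDl mul1r addrC.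
Qed.

(** The product is dual to the shuffle coproduct: a word pairs with it through the words obtained by
    deleting one [k]. *)
Lemma pairing_letter_neq0 phi j : CU D phi ->
  pairing D (fun g => x g * phi g) j <> 0 ->
  exists j1 j2, j = j1 ++ k :: j2 /\ pairing D phi (j1 ++ j2) <> 0.
Proof.
elim: j phi => [|l j IH] phi cphi; first by rewrite pairing_letter_nil.
rewrite pairing_letter_cons // => nz.
have [e|/IH] := pselect (pairing D (fun g => x g * act D l phi g) j = 0).
  move: nz; rewrite e subr0; case: eqP => [-> nz|_]; last by rewrite mul0r.
  by exists [::], j; split=> //= p0; apply: nz; rewrite p0 mulr0.
case=> [|j1 [j2 [-> nz']]]; first exact: CU_act.
exists (l :: j1), j2; split=> // p0; apply: nz'.
by rewrite pairing_act // -cat_cons p0 oppr0.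
Qed.

End Letter.

Lemma letter_exists k : exists2 x, CU D x & pairing D x [:: k] <> 0.
Proof.
have [_ fk0 _] := pg_f D k.
have [[a b] fab] : exists ab, f k ab.1 ab.2 <> 0.
  apply: contrapT => nE; apply: fk0; apply/matrixP => a b; rewrite mxE.
  by apply: contrapT => ab; apply: nE; exists (a, b).
(* The derivative at 1 of a matrix coordinate along f_k is the corresponding entry of f_k. *)
exists (toCU 'X_(mxvec_index a b)); first exact: CU_toCU.
rewrite (pairingE _ (toCU_represents _)) /wpair /= lderivU.
rewrite /mxev rmorph_sum (bigD1 b) //= big1 => [|l lb].
  by rewrite addr0 rmorphM /= mmapC mmapX mmap1U mxvecE mxE eqxx mulr1.
by rewrite rmorphM /= mmapC mmapX mmap1U mxvecE mxE (negPf lb) mulr0.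
Qed.

End Pullback.

(** * Perfect bases *)

Section PerfectBasis.
Variables (R : realType) (n : nat) (I : finType) (D : pinned_group R n I).
Variable S : set ('M[R[i]]_n.+1 -> R[i]).
Hypothesis perfS : perfect_basis D S.
Local Notation C := R[i].
Local Notation M := 'M[C]_n.+1.
Local Notation pr := (pairing D).
Implicit Types (phi psi tau sigma : M -> C) (k : I) (j : seq I).

Lemma basis_CU tau : S tau -> CU D tau.
Proof. by have [H _ _] := pb_basis perfS; exact: H. Qed.

Lemma basis_scale sigma tau (c : C) : S sigma -> S tau ->
  (forall j, pr sigma j = c * pr tau j) -> sigma = tau.
Proof.
move=> Ss St E; apply: contrapT => st.
have [_ _ free] := pb_basis perfS.
pose t (k : 'I_2) := if k == ord0 then sigma else tau.
pose a (k : 'I_2) : C := if k == ord0 then 1 else - c.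
have sE : sigma = (fun g => c * tau g).
  apply: CU_ext => [||j]; [exact: basis_CU | exact/CU_Z/basis_CU |].
  by rewrite pairingZ //; exact: basis_CU.
have : a ord0 = 0.
  apply: (free 2 a t) => [k1 k2|k|u].
  - rewrite /t; case: (unliftP ord0 k1) => [l1 ->|->]; case: (unliftP ord0 k2) => [l2 ->|->];
      rewrite ?eqxx //= => e.
      by rewrite (ord1 l1) (ord1 l2).
    by case: st; rewrite e.
  - by rewrite /t; case: eqP.
  - by rewrite !big_ord_recl big_ord0 /a /t /= mul1r sE addr0 mulNr subrr.
by move/eqP; rewrite oner_eq0.
Qed.

Lemma basis_neq0 tau : S tau -> exists j, pr tau j <> 0.
Proof.
move=> St; apply: contrapT => nE; have [_ _ free] := pb_basis perfS.
have t0 : tau = fun=> 0.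
  apply: CU_ext => [||j]; [exact: basis_CU | exact: CU_0 |].
  by rewrite pairing0; apply: contrapT => j0; apply: nE; exists j.
have := free 1 (fun=> 1) (fun=> tau) _ (fun=> St) _ ord0.
move=> H; suff : (1 : C) = 0 by move/eqP; rewrite oner_eq0.
apply: H => [k1 k2 _|u]; first by rewrite (ord1 k1) (ord1 k2).
by rewrite big_ord1 t0 mulr0.
Qed.

(** Nonnegative coefficients cannot cancel: the total coefficient of a basis element other than
    [tau] is zero, hence so is each of its summands. *)
Lemma nonneg_support m (a : 'I_m -> C) (s : 'I_m -> M -> C) tau (c : C) :
  (forall l, 0 <= a l /\ S (s l)) -> S tau ->
  (forall j, \sum_l a l * pr (s l) j = c * pr tau j) ->
  forall l, a l <> 0 -> s l = tau.
Proof.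
move=> as_ St E l0 al0; apply: contrapT => st.
have [_ _ free] := pb_basis perfS.
have a0 l : 0 <= a l by have [] := as_ l.
have Ss l : S (s l) by have [] := as_ l.
pose T : eqType := {classic (M -> C)}.
pose s' l : T := s l.
(* The family [s] may have repetitions, whereas independence concerns injective families; [u] lists
   the distinct elements and [b] gives their total coefficients. *)
pose u : seq T := undup ((tau : T) :: [seq s' l | l <- enum 'I_m]).
have uS x : x \in u -> S x.
  rewrite mem_undup inE => /orP[/eqP -> // | /mapP[l _ ->]]; exact: Ss.
have su l : s' l \in u.
  by rewrite mem_undup inE map_f ?orbT // mem_enum.
have tu : (tau : T) \in u by rewrite mem_undup inE eqxx.
pose b (x : T) : C := \sum_(l | s' l == x) a l - (if x == tau :> T then c else 0).
have pick (F : T -> C) y : y \in u -> \sum_(x <- u) (if y == x then F x else 0) = F y.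
  move=> yu; rewrite (bigD1_seq y) ?undup_uniq //= eqxx big1 ?addr0 // => x xy.
  by rewrite eq_sym (negPf xy).
have sumb (F : T -> C) : \sum_(x <- u) b x * F x = \sum_l a l * F (s' l) - c * F tau.
  rewrite (eq_bigr (fun x => \sum_l (if s' l == x then a l * F x else 0)
      - (if (tau : T) == x then c * F x else 0))) => [|x _].
    rewrite big_split /= sumrN pick // exchange_big; congr (_ - _).
    by apply: eq_bigr => l _; rewrite (pick (fun x => a l * F x)).
  rewrite /b mulrBl [in LHS]big_mkcond mulr_suml (eq_sym x); congr (_ - _).
    by apply: eq_bigr => l _; case: ifP; rewrite ?mul0r.
  by case: ifP; rewrite ?mul0r.
have sE : (fun g => \sum_l a l * s l g) = (fun g => c * tau g).
  apply: CU_ext => [||j]; [exact/CU_sum/(fun l => basis_CU (Ss l)) | exact/CU_Z/basis_CU |].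
  rewrite pairing_sum => [|l]; last exact: basis_CU.
  by rewrite E pairingZ //; exact: basis_CU.
have iu : (index (s' l0) u < size u)%N by rewrite index_mem.
have := free (size u) (fun q => b (nth (tau : T) u q)) (fun q => nth (tau : T) u q).
move=> /(_ _ _ _ (Ordinal iu)) /= H.
have : b (s' l0) = 0.
  rewrite -[s' l0](nth_index (tau : T) (su l0)); apply: H => [k1 k2|k|g].
  - by move/eqP; rewrite nth_uniq ?undup_uniq // => /eqP e; exact: val_inj.
  - exact/uS/mem_nth.
  - rewrite -(big_mkord xpredT (fun q => b (nth (tau : T) u q) * nth (tau : T) u q g)).
    rewrite -(big_nth (tau : T) xpredT (fun x : T => b x * x g)).
    rewrite (sumb (fun x : T => x g)).
    by have /= -> := congr1 (fun phi => phi g) sE; rewrite subrr.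
rewrite /b; have /negPf -> : s' l0 != tau :> T by apply/eqP.
rewrite subr0 => /eqP; rewrite psumr_eq0 // => /allP /(_ l0 (mem_index_enum _)).
by rewrite eqxx => /eqP.
Qed.

(** This expresses f_k^m . tau <> 0 by words, free of the signs of [act]. *)
Definition reaches k tau m : Prop := exists j, pr tau (nseq m k ++ j) <> 0.

Lemma reachesW k tau m m' : (m' <= m)%N -> reaches k tau m -> reaches k tau m'.
Proof.
move=> m'm [j pj]; exists (nseq (m - m') k ++ j).
by rewrite catA -nseqD subnKC.
Qed.

Definition string_length k tau m : Prop :=
  reaches k tau m /\ ~ reaches k tau m.+1.

Lemma iter_act k m phi : CU D phi -> CU D (iter m (act D k) phi) /\
  forall j, pr (iter m (act D k) phi) j = (-1) ^+ m * pr phi (nseq m k ++ j).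
Proof.
move=> cphi; elim: m => [|m [cm IH]].
  by split=> // j; rewrite expr0 mul1r.
split=> [|j]; first exact: CU_act.
rewrite [iter _ _ _]/= pairing_act // IH exprS mulN1r mulNr.
by rewrite -[k :: j]/(nseq 1 k ++ j) catA -nseqD addn1.
Qed.

Lemma iter_act_neq0 k m phi : CU D phi ->
  iter m (act D k) phi <> (fun=> 0) <-> reaches k phi m.
Proof.
move=> cphi; have [cm E] := iter_act k m cphi; split=> [nz|[j pj] z].
  apply: contrapT => nr; apply: nz; apply: CU_ext => [||j]; [exact: cm | exact: CU_0 |].
  rewrite pairing0 E (_ : pr phi _ = 0) ?mulr0 //.
  by apply: contrapT => pj; apply: nr; exists j.
apply: pj; have := E j; rewrite z pairing0 => /esym/eqP.
by rewrite mulf_eq0 signr_eq0 => /eqP.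
Qed.

Lemma eps_isP k phi m : CU D phi -> eps_is D k phi m <-> string_length k phi m.
Proof.
move=> cphi; rewrite /eps_is; split=> [[/(iter_act_neq0 _ _ cphi) rm max]|[rm nr]].
  by split=> // /(iter_act_neq0 _ _ cphi)/max; rewrite ltnn.
split=> [|m' /(iter_act_neq0 _ _ cphi) rm']; first exact/iter_act_neq0.
by rewrite leqNgt; apply/negP => mm'; apply: nr; exact: reachesW mm' rm'.
Qed.

Lemma string_length_exists k tau : S tau -> exists m, string_length k tau m.
Proof.
move=> St; have [d [_ hd]] := pb_homogeneous perfS St.
have bound m : reaches k tau m -> (m <= d k)%N.
  move=> [j /hd <-]; rewrite ffunE count_cat count_nseq /= eqxx mul1n.
  exact: leq_addr.
have r0 : reaches k tau 0 by have [j] := basis_neq0 St; exists j.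
have ex : exists m, `[< reaches k tau m >] by exists 0%N; apply/asboolP.
have bd m : `[< reaches k tau m >] -> (m <= d k)%N by move/asboolP/bound.
case: (ex_maxnP ex bd) => m /asboolP rm max; exists m; split=> // rm'.
by have := max m.+1; rewrite ltnn => H; apply: notF; apply: H; apply/asboolP.
Qed.

Lemma string_length_uniq k tau m m' :
  string_length k tau m -> string_length k tau m' -> m = m'.
Proof.
move=> [rm nm] [rm' nm']; apply/eqP; rewrite eqn_leq.
apply/andP; split; rewrite leqNgt; apply/negP => lt.
  by apply: nm'; exact: reachesW lt rm.
by apply: nm; exact: reachesW lt rm'.
Qed.

(** The error term of a perfect basis is killed by f_k^m, where m + 1 is the length of the string of
    [tau], so it disappears on words starting with m letters [k]. *)
Lemma etildeP k tau tau0 : etilde_rel D S k tau tau0 ->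
  exists m (c : C), [/\ string_length k tau m.+1, string_length k tau0 m, c <> 0
    & forall j, pr tau (nseq m.+1 k ++ j) = c * pr tau0 (nseq m k ++ j)].
Proof.
case=> St St0 nz [c [m [c0 em lt]]]; have ct := basis_CU St; have ct0 := basis_CU St0.
have sm := (eps_isP _ _ ct).1 em.
case: m em sm lt => [|m] em sm [cd lt].
  by case: sm => _ []; exact/(iter_act_neq0 k 1 ct).
have low m' j : (m <= m')%N -> - pr tau (k :: nseq m' k ++ j) = c * pr tau0 (nseq m' k ++ j).
  move=> mm'; apply/eqP; rewrite -subr_eq0 -pairing_act //.
  have cN := CU_Z (- c) ct0.
  have -> : pr (act D k tau) (nseq m' k ++ j) - c * pr tau0 (nseq m' k ++ j)
      = pr (fun u => act D k tau u - c * tau0 u) (nseq m' k ++ j).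
    rewrite -mulNr -pairingZ // -pairingD //; last exact: CU_act.
    by congr pairing; apply/funext => u; rewrite mulNr.
  move: lt cd => /=; set psi := fun _ => _ => lt cd; apply/eqP.
  case: lt => [->|[e /(eps_isP _ _ cd)[_ ne] em']]; first by rewrite pairing0.
  apply: contrapT => nz'; apply: ne; apply: (@reachesW _ _ m'); last by exists j.
  exact: leq_trans mm'.
(* The sign undoes the one in [act]. *)
exists m, (- c); split=> //.
- case: sm => [[j pj] nr]; split.
    exists j => p0; apply: pj; apply/eqP; rewrite -oppr_eq0.
    by rewrite /= low // p0 mulr0.
  case=> j' pj'; apply: nr; exists j' => p0; apply: pj'; apply/eqP.
  have /esym/eqP := low m.+1 j' (leqnSn m).
  by rewrite p0 oppr0 mulf_eq0 => /orP[/eqP//|].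
- by move/eqP; rewrite oppr_eq0 => /eqP.
- by move=> j; rewrite mulNr -low // opprK.
Qed.

Lemma etilde_exists k tau m : S tau -> string_length k tau m.+1 ->
  exists tau0, etilde_rel D S k tau tau0.
Proof.
move=> St [rm _]; have nz : act D k tau <> (fun=> 0).
  by apply/(iter_act_neq0 k 1 (basis_CU St)); exact: reachesW rm.
by have [tau0 [E _]] := pb_etilde perfS St nz; exists tau0.
Qed.

(** Iterating e~_k to the end of the string leaves no error term: f_k^m . tau is a multiple of a
    single basis element. *)
Lemma string_top k tau m : S tau -> string_length k tau m ->
  exists tau0 (c : C), [/\ S tau0, c <> 0
    & forall j, pr tau (nseq m k ++ j) = c * pr tau0 j].
Proof.
elim: m tau => [|m IH] tau St sm.
  exists tau, 1; split=> // [|j]; last by rewrite mul1r.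
  by move/eqP; rewrite oner_eq0.
have [tau1 E] := etilde_exists St sm; have [_ St1 _ _] := E.
have [m' [c [sm' sm1 c0 cE]]] := etildeP E.
have [mm'] := string_length_uniq sm sm'.
rewrite -mm' in sm1 cE; have [tau0 [c' [St0 c'0 c'E]]] := IH _ St1 sm1.
exists tau0, (c * c'); split=> // [/eqP|j]; last by rewrite cE c'E mulrA.
by rewrite mulf_eq0 => /orP[]/eqP.
Qed.

(** Elements with proportional images under f_k^m have the same end of string; injectivity of e~_k
    then climbs back. *)
Lemma string_top_inj k sigma tau m (c : C) : S sigma -> S tau ->
  string_length k sigma m -> string_length k tau m ->
  (forall j, pr sigma (nseq m k ++ j) = c * pr tau (nseq m k ++ j)) -> sigma = tau.
Proof.
elim: m sigma tau c => [|m IH] sigma tau c Ss St es et E.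
  exact: (basis_scale Ss St E).
have [s1 Es] := etilde_exists Ss es; have [t1 Et] := etilde_exists St et.
have [_ Ss1 _ _] := Es; have [_ St1 _ _] := Et.
have [ms [cs [es' es1 cs0 csE]]] := etildeP Es.
have [mt [ct [et' et1 ct0 ctE]]] := etildeP Et.
have [ems] := string_length_uniq es es'; have [emt] := string_length_uniq et et'.
rewrite -ems in es1 csE; rewrite -emt in et1 ctE.
suff s1t1 : s1 = t1 by rewrite s1t1 in Es; exact: (pb_etilde_inj perfS Es Et).
apply: (IH _ _ (cs^-1 * (c * ct)) Ss1 St1 es1 et1) => j.
apply: (mulfI (x := cs)); first exact/eqP.
by rewrite -csE E ctE !mulrA divff ?mul1r //; exact/eqP.
Qed.

(** Since the basis spans, some element pairs nontrivially with the word [k]. It is homogeneous, and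
    no other word has that content. *)
Lemma letter_basis tau0 k : S tau0 -> homogeneous D tau0 [ffun=> 0%N] ->
  pr tau0 [::] = 1 -> exists x, [/\ S x, etilde_rel D S k x tau0, pr x [:: k] <> 0
    & forall j, j <> [:: k] -> pr x j = 0].
Proof.
move=> St0 [ct0 h0] t01; have [phi cphi phik] := letter_exists D k.
have [_ span _] := pb_basis perfS; have [m [a [s [as_ phiE]]]] := span _ cphi.
have [l sk] : exists l, pr (s l) [:: k] <> 0.
  apply: contrapT => nE; apply: phik; rewrite phiE pairing_sum => [|l]; last first.
    by apply: basis_CU; have [] := as_ l.
  apply: big1 => l _; rewrite (_ : pr _ _ = 0) ?mulr0 //.
  by apply: contrapT => sl; apply: nE; exists l.
have [_ Sx] := as_ l; exists (s l); set x := s l in sk Sx *.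
have cx := basis_CU Sx; have [d [_ hd]] := pb_homogeneous perfS Sx.
have dk := hd _ sk.
have x0 j : j <> [:: k] -> pr x j = 0.
  move=> jk; apply: contrapT => /hd; rewrite -dk => /ffunP ck; apply: jk.
  apply/perm_small_eq => //; apply/allP => i _ /=; have := ck i.
  by rewrite !ffunE => /eqP.
have t00 j : j <> [::] -> pr tau0 j = 0.
  case: j => // i j _; apply: contrapT => /h0/ffunP/(_ i).
  by rewrite !ffunE /= eqxx.
have actE : act D k x = fun g => - pr x [:: k] * tau0 g.
  apply: CU_ext => [||j]; [exact: CU_act | exact: CU_Z |].
  rewrite pairing_act // pairingZ //; case: j => [|i j]; first by rewrite t01 mulr1.
  by rewrite x0 // t00 // mulr0 oppr0.
have xk0 : - pr x [:: k] <> 0 by move/eqP; rewrite oppr_eq0 => /eqP.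
split=> //; split=> //.
  move=> act0; apply: xk0; rewrite -pairing_act // act0; exact: pairing0.
exists (- pr x [:: k]), 1%N; split=> //.
  apply/eps_isP => //; split; first by exists [::].
  by case=> j; rewrite /= x0.
rewrite actE (_ : (fun u => _) = fun=> 0); first by split; [exact: CU_0 | left].
by apply/funext => u; rewrite subrr.
Qed.

(** If no function had the reversed pairings, [star] would return its default 0, which cannot lie in
    a basis. *)
Lemma star_basis tau : S tau -> S (star D tau) /\
  forall j, pr (star D tau) j = pr tau (rev j).
Proof.
move=> St; have Ss : S (star D tau) by rewrite -(pb_star perfS); exists tau.
split=> // j; pose X : set (M -> C) :=
  [set psi | CU D psi /\ forall j, pr psi j = pr tau (rev j)].
have [[psi Xpsi]|nX] := pselect (exists psi, X psi).
  by have [_ ->] : X (star D tau) by exact: xgetPex (ex_intro _ _ Xpsi).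
have s0 : star D tau = fun=> 0.
  by apply: xgetPN => psi Xpsi; apply: nX; exists psi.
by have [j'] := basis_neq0 Ss; rewrite s0 pairing0.
Qed.

(** * Consequences of positivity *)

Section Positivity.
Hypothesis act_pos : forall tau k, S tau ->
  combination [set c : C | 0 <= c] S (fun u => - act D k tau u).
Hypothesis mul_pos : forall k, exists x,
  [/\ CU D x, pr x [:: k] <> 0, forall j, j <> [:: k] -> pr x j = 0
    & forall tau, S tau -> combination [set c : C | 0 <= c] S (fun u => x u * tau u)].

Lemma pairing_combination phi m (a : 'I_m -> C) (s : 'I_m -> M -> C) j :
  (forall l, (0 <= a l) /\ S (s l)) -> phi = (fun u => \sum_l a l * s l u) ->
  pr phi j = \sum_l a l * pr (s l) j.
Proof.
by move=> as_ ->; rewrite pairing_sum // => l; apply: basis_CU; have [] := as_ l.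
Qed.

Lemma act_combination tau k : S tau -> exists m (a : 'I_m -> C) (s : 'I_m -> M -> C),
  (forall l, (0 <= a l) /\ S (s l)) /\
  forall j, pr tau (k :: j) = \sum_l a l * pr (s l) j.
Proof.
move=> St; have [m [a [s [as_ E]]]] := act_pos k St.
exists m, a, s; split=> // j; rewrite -(pairing_combination j as_ E) //.
have ct := basis_CU St; rewrite (_ : (fun u => _) = fun u => (-1) * act D k tau u).
  by rewrite pairingZ ?pairing_act ?mulN1r ?opprK //; exact: CU_act.
by apply/funext => u; rewrite mulN1r.
Qed.

Lemma pairing_ge0 tau j : S tau -> 0 <= pr tau j.
Proof.
elim: j tau => [|k j IH] tau St; last first.
  have [m [a [s [as_ ->]]]] := act_combination k St.
  by apply: sumr_ge0 => l _; have [al sl] := as_ l; rewrite mulr_ge0 ?IH.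
(* An element pairing nontrivially with the empty word has degree 0, so it is the unit, with pairing
   1. *)
have [->|nz] := pselect (pr tau [::] = 0); first by [].
have [d hd] := pb_homogeneous perfS St; have [tau0 [t01 H]] := pb_degree0 perfS.
suff -> : tau = tau0 by rewrite t01 ler01.
apply/H; split=> //; suff <- : d = [ffun=> 0%N] by [].
by case: hd => _ /(_ _ nz) <-; apply/ffunP => i; rewrite !ffunE.
Qed.

(* Applying f_k^e turns both sides into nonnegative combinations of the basis,
   the right-hand side into a multiple of a single element. *)
Lemma leading_term k m (a : 'I_m -> C) (s : 'I_m -> M -> C) tau e (c : C) :
  (forall l, 0 <= a l /\ S (s l)) -> S tau -> string_length k tau e -> c <> 0 ->
  (forall j, \sum_l a l * pr (s l) (nseq e k ++ j) = c * pr tau (nseq e k ++ j)) ->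
  exists2 l, a l <> 0 & s l = tau.
Proof.
move=> as_ St [re nre] c0 E.
have a0 l : 0 <= a l by have [] := as_ l.
have Ss l : S (s l) by have [] := as_ l.
have ap0 l j : 0 <= a l * pr (s l) j by rewrite mulr_ge0 ?pairing_ge0.
have [rho [ct [Sr ct0 ctE]]] := string_top St (conj re nre).
(* One more f_k kills the right-hand side, hence each nonnegative summand separately. *)
have above l : a l <> 0 -> ~ reaches k (s l) e.+1.
  move=> al [j]; rewrite -addn1 nseqD -catA; apply.
  have := E ([:: k] ++ j); rewrite (_ : pr tau _ = 0) ?mulr0; last first.
    by apply: contrapT => nz; apply: nre; exists j; rewrite -addn1 nseqD -catA.
  move/eqP; rewrite psumr_eq0 // => /allP /(_ l (mem_index_enum _)) /=.
  by rewrite mulf_eq0 => /orP[/eqP|/eqP].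
(* A summand surviving f_k^e has string length exactly [e], so it becomes a multiple of one basis
   element, and a nonnegative multiple because pairings are nonnegative. Killed summands receive the
   dummy value [(0, tau)]. *)
have top l : exists br : C * (M -> C),
    [/\ 0 <= br.1, S br.2, forall j, a l * pr (s l) (nseq e k ++ j) = br.1 * pr br.2 j
      & (exists j, a l * pr (s l) (nseq e k ++ j) <> 0) -> br.1 <> 0].
  have [[j nz]|z] := pselect (exists j, a l * pr (s l) (nseq e k ++ j) <> 0); last first.
    exists (0, tau); split=> // j; rewrite mul0r.
    by apply: contrapT => nz; apply: z; exists j.
  have al : a l <> 0 by move=> al; apply: nz; rewrite al mul0r.
  have sl : string_length k (s l) e.
    by split; [exists j => p0; apply: nz; rewrite p0 mulr0 | exact: above].
  have [r [cl [Sr' cl0 clE]]] := string_top (Ss l) sl.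
  have cl_ge0 : 0 <= cl.
    have := pairing_ge0 (nseq e k ++ j) (Ss l); rewrite clE.
    rewrite pmulr_lge0 // lt_neqAle pairing_ge0 // andbT eq_sym; apply/eqP => r0.
    by apply: nz; rewrite clE r0 !mulr0.
  exists (a l * cl, r); split=> //= [|j'|_ /eqP]; first by rewrite mulr_ge0.
    by rewrite clE mulrA.
  by rewrite mulf_eq0 => /orP[]/eqP.
have [br brP] := choice top.
have [j pj] := re.
have [l lnz] : exists l, a l * pr (s l) (nseq e k ++ j) <> 0.
  apply: contrapT => nE; apply: pj; apply/eqP; rewrite -(mulrI_eq0 _ (x := c)).
    rewrite -E big1 // => l _.
    by apply: contrapT => lnz; apply: nE; exists l.
  by apply/lregP/eqP.
have al : a l <> 0 by move=> al; apply: lnz; rewrite al mul0r.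
exists l => //.
have rl : (br l).2 = rho.
  apply: (@nonneg_support _ (fun l => (br l).1) (fun l => (br l).2) rho (c * ct)) => //.
  - by move=> l'; have [] := brP l'.
  - move=> j'; rewrite -mulrA -ctE -E; apply: eq_bigr => l' _.
    by have [_ _ -> _] := brP l'.
  - by have [_ _ _] := brP l; apply; exists j.
have [_ _ bE bnz] := brP l.
apply: (@string_top_inj k _ _ e ((a l)^-1 * (br l).1 * ct^-1)) => //.
  by split; [exists j => p0; apply: lnz; rewrite p0 mulr0 | exact: above].
move=> j'; apply: (mulfI (x := a l)); first exact/eqP.
rewrite bE rl ctE !mulrA divff; last exact/eqP.
by rewrite mul1r divfK //; exact/eqP.
Qed.

Lemma etilde_act k tau tau0 j : etilde_rel D S k tau tau0 ->
  pr tau0 j <> 0 -> pr tau (k :: j) <> 0.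
Proof.
move=> E nz; have [St St0 _ _] := E.
have [e [c [_ s0 c0 cE]]] := etildeP E.
have [m [a [s [as_ aE]]]] := act_combination k St.
have [l al sl] : exists2 l, a l <> 0 & s l = tau0.
  by apply: (leading_term as_ St0 s0 c0) => j'; rewrite -aE -cE.
rewrite aE => /eqP; rewrite psumr_eq0 => [|l' _]; last first.
  by have [al' sl'] := as_ l'; rewrite mulr_ge0 ?pairing_ge0.
move/allP/(_ l (mem_index_enum _)) => /=.
by rewrite sl mulf_eq0 => /orP[]/eqP.
Qed.

(* tau occurs in x tau0, and multiplication by x is dual to deleting a k. *)
Lemma etilde_delete k tau tau0 j : etilde_rel D S k tau tau0 -> pr tau j <> 0 ->
  exists j1 j2, j = j1 ++ k :: j2 /\ pr tau0 (j1 ++ j2) <> 0.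
Proof.
move=> E nz; have [St St0 _ _] := E.
have ct0 := basis_CU St0.
have [e [c [se s0 c0 cE]]] := etildeP E.
have [x [cx xk x0 xpos]] := mul_pos k.
have [m [a [s [as_ aE]]]] := xpos _ St0.
have pE j' := pairing_combination j' as_ aE.
have [l al sl] : exists2 l, a l <> 0 & s l = tau.
  (* The Leibniz rule gives e + 1 times the pairing of [x] with [k]; dividing by [c] passes from
     f_k^e . tau0 to f_k^(e+1) . tau. *)
  apply: (leading_term (c := e.+1%:R * pr x [:: k] / c) as_ St se).
    apply/eqP; rewrite !mulf_neq0 ?invr_eq0 ?pnatr_eq0 //; exact/eqP.
  move=> j'; rewrite -pE // pairing_letter_nseq //.
    by rewrite cE mulrA divfK //; exact/eqP.
  move=> j''; apply: contrapT => nz'; case: s0 => _; apply.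
  by exists j''.
apply: (pairing_letter_neq0 cx x0 ct0); rewrite pE //.
move/eqP; rewrite psumr_eq0 => [|l' _]; last first.
  by have [al' sl'] := as_ l'; rewrite mulr_ge0 ?pairing_ge0.
move/allP/(_ l (mem_index_enum _)) => /=.
by rewrite sl mulf_eq0 => /orP[]/eqP.
Qed.

End Positivity.
End PerfectBasis.

(** * Extremal exponents *)

(** The order is meant for sequences of equal length, for which the default case only meets two
    empty ones. *)
Fixpoint lexle (a b : seq nat) : bool :=
  match a, b with
  | x :: a', y :: b' => (x < y)%N || ((x == y) && lexle a' b')
  | _, _ => true
  end.

(** An increment counts more the earlier it stands, and the larger sequence receives the earlier
    one. *)
Lemma lexle_incr_nth a b p q : size a = size b -> (q <= p < size a)%N ->
  lexle a b -> lexle (incr_nth a p) (incr_nth b q).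
Proof.
elim: a b p q => [|x a IH] [|y b] p q //=; first by rewrite andbF.
move=> [sab]; case: p => [|p]; case: q => [|q] //=.
- by move=> _ /orP[xy|/andP[/eqP-> _]]; rewrite ltnS ?(ltnW xy) ?leqnn.
- by move=> pq /orP[->//|/andP[-> /(IH _ _ _ sab pq) ->]]; rewrite orbT.
Qed.

Lemma lexle_rcons a b x : size a = size b -> lexle a b ->
  lexle (rcons a x) (rcons b x).
Proof.
elim: a b => [|y a IH] [|z b] //=; first by rewrite eqxx orbT.
by move=> [sab] /orP[->//|/andP[-> /(IH _ sab) ->]]; rewrite orbT.
Qed.

Lemma rev_incr_nth a p : (p < size a)%N ->
  rev (incr_nth a p) = incr_nth (rev a) (size a - p.+1).
Proof.
move=> pa; have s : size (incr_nth a p) = size a by rewrite size_incr_nth pa.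
have s' : size (incr_nth (rev a) (size a - p.+1)) = size a.
  by rewrite size_incr_nth size_rev -subSn // subSS leq_subr.
apply: (@eq_from_nth _ 0%N) => [|k]; rewrite size_rev s; first by rewrite s'.
move=> ka; rewrite nth_rev ?s // !nth_incr_nth nth_rev //; congr (_ + _)%N.
by lia.
Qed.

Lemma word_delete (I : eqType) (x : I) (j : seq I) a j1 k j2 : size a = size j ->
  word j a = j1 ++ k :: j2 ->
  exists a' l, [/\ size a' = size j, (l < size j)%N, a = incr_nth a' l
    & word j a' = j1 ++ j2].
Proof.
elim: j a j1 => [|y j IH] [|e a] j1 //=; first by case: j1.
case=> sa; elim: e j1 => [|e IHe] j1 /=.
  move/(IH _ _ sa) => [a' [l [sa' lj -> wE]]].
  by exists (0%N :: a'), l.+1; rewrite /= sa'.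
case: j1 => [[_]|z j1 [<-]] /=.
  by move<-; exists (e :: a), 0%N; rewrite /= sa.
move/IHe => [[|e' a'] [l [//= sa' lj aE wE]]].
exists (e'.+1 :: a'), l; split=> //=; last by rewrite wE.
by case: l {lj} aE => [[-> ->]|l [-> ->]].
Qed.

Lemma word_incr0 (I : Type) (k : I) (j : seq I) a : size a = (size j).+1 ->
  word (k :: j) (incr_nth a 0) = k :: word (k :: j) a.
Proof. by case: a. Qed.

Lemma word_cat (I : Type) (j j' : seq I) a a' : size a = size j ->
  word (j ++ j') (a ++ a') = word j a ++ word j' a'.
Proof. by elim: j a => [|k j IH] [|e a] //= [/IH ->]; rewrite catA. Qed.

Lemma word_rev (I : Type) (j : seq I) a : size a = size j ->
  word (rev j) (rev a) = rev (word j a).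
Proof.
elim: j a => [|k j IH] [|e a] //= [sa]; rewrite !rev_cons -!cats1.
rewrite word_cat ?size_rev // IH // rev_cat /= cats0; congr (_ ++ _).
by rewrite rev_nseq.
Qed.

(* supp tau j stands for <tau, j> <> 0, lowers k tau tau0 for
   tau0 = e~_k tau, and height k tau e for eps_k tau = e. *)
Section Extremal.
Variables (I : eqType) (T : Type) (S : T -> Prop).
Variables (supp : T -> seq I -> Prop) (lowers : I -> T -> T -> Prop).
Hypothesis lowers_S : forall k tau tau0, lowers k tau tau0 -> S tau0.
Hypothesis supp_raise : forall k tau tau0 j,
  lowers k tau tau0 -> supp tau0 j -> supp tau (k :: j).
Hypothesis supp_delete : forall k tau tau0 j, lowers k tau tau0 -> supp tau j ->
  exists j1 j2, j = j1 ++ k :: j2 /\ supp tau0 (j1 ++ j2).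
Variable height : I -> T -> nat -> Prop.
Hypothesis height_exists : forall k tau, S tau -> exists e, height k tau e.
Hypothesis height0 : forall k tau j, height k tau 0 -> ~ supp tau (k :: j).
Hypothesis heightS : forall k tau e, S tau -> height k tau e.+1 ->
  exists tau0, lowers k tau tau0 /\ height k tau0 e.

Definition exponent (j : seq I) (tau : T) (a : seq nat) : Prop :=
  size a = size j /\ supp tau (word j a).

Lemma exponent_raise k j tau tau0 a : lowers k tau tau0 ->
  exponent (k :: j) tau0 a -> exponent (k :: j) tau (incr_nth a 0).
Proof.
move=> low [sa wa]; split; first by rewrite size_incr_nth sa.
by rewrite word_incr0 //; exact: supp_raise low wa.
Qed.

Lemma exponent_lower k j tau tau0 a : lowers k tau tau0 -> exponent j tau a ->
  exists a' l, [/\ exponent j tau0 a', (l < size j)%N & a = incr_nth a' l].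
Proof.
move=> low [sa wa]; have [j1 [j2 [jE s0]]] := supp_delete low wa.
have [a' [l [sa' lj aE wE]]] := word_delete k sa jE.
by exists a', l; split=> //; split=> //; rewrite wE.
Qed.

(** One [m] serves both orders: an increment of the first entry is the strongest one
    lexicographically, and the weakest one after reversal. *)
Lemma extremal_exponent j tau : S tau -> (exists a, exponent j tau a) ->
  exists2 m, exponent j tau m &
    forall a, exponent j tau a -> lexle a m && lexle (rev m) (rev a).
Proof.
elim: j tau => [|k j IH] tau St [a0 Ma0].
  exists [::]; last by case=> [|? ?] [].
  by case: a0 Ma0 => [|? ?] [].
have [e he] := height_exists k St.
elim: e tau St a0 Ma0 he => [|e IHe] tau St a0 Ma0 he.
  (* At height 0 no word starting with [k] pairs with [tau], so the first entry of every exponent is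
     0. *)
  have tail a : exponent (k :: j) tau a -> exists2 a', a = 0%N :: a' & exponent j tau a'.
    case: a => [[//]|[|x] a [/= [sa] wa]]; first by exists a.
    by case: (height0 he wa).
  have [a0' _ Ma0'] := tail _ Ma0.
  have [m [sm wm] mP] := IH _ St (ex_intro _ a0' Ma0').
  exists (0%N :: m); first by split; rewrite /= ?sm.
  move=> _ /tail[a -> Ma]; have /andP[am ma] := mP _ Ma; case: Ma => sa _.
  by rewrite /= am !rev_cons lexle_rcons // !size_rev sm.
have [tau0 [low he0]] := heightS St he.
have [a0' [_ [Ma0' _ _]]] := exponent_lower low Ma0.
have [m Mm mP] := IHe _ (lowers_S low) _ Ma0' he0.
exists (incr_nth m 0); first exact: exponent_raise low Mm.
move=> _ /(exponent_lower low)[a [l [Ma lj ->]]].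
have /andP[am ma] := mP _ Ma; case: Ma Mm => sa _ [sm _].
rewrite lexle_incr_nth ?sa ?sm //= !rev_incr_nth ?sa ?sm //.
by apply: lexle_incr_nth => //; rewrite !size_rev ?sa ?sm //; lia.
Qed.

End Extremal.

Lemma tuplelexi_lexle r (a b : r.-tuple nat) :
  ((a : r.-tuplelexi nat) <= (b : r.-tuplelexi nat))%O = lexle a b.
Proof.
rewrite -[LHS]/((a : seqlexi nat) <= b)%O; have : size a = size b by rewrite !size_tuple.
case: a b => [a /= _] [b /= _].
elim: a b => [|x a IH] [|y b] //= [sab]; rewrite lexi_cons IH // !leEnat.
by case: ltngtP => //= _; rewrite ?andbT ?andbF.
Qed.

Lemma lexmaxP r (s : seq (r.-tuplelexi nat)) m :
  m \in s -> (forall x, x \in s -> (x <= m)%O) -> lexmax s = m.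
Proof.
move=> ms le_m; apply/le_anti/andP; split; last exact: le_bigmax_seq.
rewrite /lexmax big_seq; apply: bigmax_le => //; apply: le_m.
by case: s ms => //= x s _; rewrite mem_head.
Qed.

Lemma lexminP r (s : seq (r.-tuplelexi nat)) m :
  m \in s -> (forall x, x \in s -> (m <= x)%O) -> lexmin s = m.
Proof.
move=> ms le_m; apply/le_anti/andP; split; first exact: ge_bigmin_seq.
rewrite /lexmin big_seq; apply: le_bigmin => //; apply: le_m.
by case: s ms => //= x s _; rewrite mem_head.
Qed.

Lemma op_int_vector r (a : r.-tuple nat) :
  op (int_vector a) = int_vector [tuple of rev a].
Proof.
apply/rowP => k; rewrite !mxE !(tnth_nth 0%N) /= nth_rev size_tuple //.
Qed.

Lemma op_opp r (x : 'rV[int]_r) : op (- x) = - op x.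
Proof. by apply/rowP => k; rewrite !mxE. Qed.

(** * The crystal of the quantized enveloping algebra *)

Lemma regular0_add c c' : regular0 c -> regular0 c' -> regular0 (c + c').
Proof.
move=> [p [r [r0 ->]]] [p' [r' [r'0 ->]]].
have nz s : s.[0] != 0 -> tofrac s != 0 :> Qq.
  by apply: contraNneq => /eqP; rewrite tofrac_eq0 => /eqP ->; rewrite horner0.
exists (p * r' + p' * r), (r * r'); split; first by rewrite hornerM mulf_neq0.
by rewrite addf_div ?nz // rmorphD !rmorphM.
Qed.

Lemma regular0_opp c : regular0 c -> regular0 (- c).
Proof. by move=> [p [r [r0 ->]]]; exists (- p), r; rewrite rmorphN mulNr. Qed.

Lemma regular0_0 : regular0 0.
Proof. by exists 0, 1; rewrite hornerC oner_eq0 rmorph0 mul0r. Qed.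

(** q is not invertible in the local ring at q = 0: clear denominators and evaluate at 0. *)
Lemma qvar_regular_neq1 c : regular0 c -> qvar * c != 1.
Proof.
move=> [p [r [r0 ->]]]; have nz : tofrac r != 0 :> Qq.
  by apply: contraNneq r0 => /eqP; rewrite tofrac_eq0 => /eqP ->; rewrite horner0.
apply: contraNneq r0 => E.
have : tofrac ('X * p) = tofrac r :> Qq.
  by rewrite rmorphM -[RHS]mul1r -E -[RHS]mulrA divfK.
by move/eqP; rewrite tofrac_eq => /eqP <-; rewrite hornerM hornerX mul0r.
Qed.

Lemma qvar_neq0 : qvar != 0.
Proof. by rewrite /qvar tofrac_eq0 polyX_eq0. Qed.

Lemma qvarX_neq1 m : (0 < m)%N -> qvar ^+ m != 1.
Proof.
move=> m0; rewrite /qvar -tofracXn -tofrac1 tofrac_eq.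
apply/eqP => /(congr1 (fun p : {poly rat} => size p)) /eqP.
by rewrite size_polyXn size_poly1 eqSS eqn0Ngt m0.
Qed.

Section QuantumStrings.
Variables (I : finType) (a : I -> I -> int) (Q : quantum_minus a).
Hypothesis a_diag : forall i, a i i = 2.
Local Notation A := (qm_alg Q).
Local Notation F := (@qm_F _ _ Q).
Local Notation e' := (qm_e' Q).
Local Notation dv := (@qdivided _ _ Q).
Implicit Types (i j : I) (x y : A) (s : seq I) (u : nat -> A).

Lemma qfact_neq0 i k : qfact (qvar ^+ qm_d Q i) k != 0.
Proof.
have d0 := qm_d_gt0 Q i.
have vV m : (0 < m)%N -> (qvar ^+ qm_d Q i) ^+ m - (qvar ^+ qm_d Q i) ^- m != 0.
  move=> m0; rewrite -exprM subr_eq0; set N := (_ * _)%N.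
  have N0 : (0 < N)%N by rewrite muln_gt0 d0.
  have NN : (0 < N + N)%N by rewrite addn_gt0 N0.
  apply: (contra_neq _ (qvarX_neq1 NN)) => E.
  rewrite exprD {1}E mulVf //; apply: expf_neq0; exact: qvar_neq0.
rewrite /qfact big_seq; apply: (big_ind (fun c : Qq => c != 0)) => [|x y|m]; first exact: oner_neq0.
  exact: mulf_neq0.
rewrite mem_index_iota => /andP[m0 _]; rewrite /qint mulf_neq0 ?vV //.
by rewrite invr_eq0 -{1}[qvar ^+ _]expr1 -[X in _ - X]/((_ ^+ 1)^-1) vV.
Qed.

(** The factor produced by moving e'_i past F_i^m, with ratio q_i^(-2) because a_ii = 2. *)
Definition geom i m : Qq := \sum_(l < m) ((qvar ^+ qm_d Q i) ^ (-2)) ^+ l.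

Lemma geom_neq0 i m : geom i m.+1 != 0.
Proof.
have d0 := qm_d_gt0 Q i; apply/eqP => g0.
have := subrX1 ((qvar ^+ qm_d Q i) ^ (-2)) m.+1.
rewrite -/(geom i m.+1) g0 mulr0 => /eqP; rewrite subr_eq0.
rewrite -[_ ^ (-2)]/((_ ^+ 2)^-1) exprVn invr_eq1 -!exprM; apply/negP.
by apply: qvarX_neq1; rewrite !muln_gt0 d0.
Qed.

Lemma e'_Fpow i m x : e' i x = 0 ->
  e' i (F i ^+ m.+1 * x) = geom i m.+1 *: (F i ^+ m * x).
Proof.
move=> x0; elim: m => [|m IH].
  rewrite expr1 qm_e'F x0 mulr0 scaler0 addr0 eqxx /geom big_ord1 !expr0 mul1r.
  by [].
rewrite exprS -mulrA qm_e'F IH eqxx scale1r a_diag.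
rewrite -scalerAr mulrA -exprS scalerA -[X in X + _]scale1r -scalerDl; congr (_ *: _).
rewrite [in RHS]/geom big_ord_recl expr0; congr (_ + _).
by rewrite /geom mulr_sumr; apply: eq_bigr => l _; rewrite -exprS.
Qed.

(** In closed form this is q_i^(-k). *)
Definition lower_coef i k : Qq :=
  (qfact (qvar ^+ qm_d Q i) k.+1)^-1 * geom i k.+1 * qfact (qvar ^+ qm_d Q i) k.

Lemma lower_coef_neq0 i k : lower_coef i k != 0.
Proof. by rewrite !mulf_neq0 ?invr_eq0 ?qfact_neq0 ?geom_neq0. Qed.

Lemma e'_dv i k x : e' i x = 0 -> e' i (dv i k.+1 * x) = lower_coef i k *: (dv i k * x).
Proof.
move=> x0; rewrite /qdivided /divided -!scalerAl linearZ /= e'_Fpow //.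
by rewrite !scalerA /lower_coef mulfK // qfact_neq0.
Qed.

Lemma dv0 i : dv i 0 = 1.
Proof. by rewrite /qdivided /divided /qfact big_nil invr1 scale1r expr0. Qed.

(** Uniqueness of string decompositions: e'_i kills the term u_0 and lowers the other divided powers
    by one, leaving a shorter relation. *)
Lemma string_decomp_eq0 i m u : (forall k, e' i (u k) = 0) ->
  \sum_(k < m) dv i k * u k = 0 -> forall k, (k < m)%N -> u k = 0.
Proof.
elim: m u => // m IH u u0 E.
have uS k : (k < m)%N -> u k.+1 = 0.
  move=> km; pose u' l := lower_coef i l *: u l.+1.
  have /eqP : u' k = 0.
    apply: IH => // [l|]; first by rewrite linearZ /= u0 scaler0.
    have := congr1 (e' i) E; rewrite linear0 linear_sum big_ord_recl.
    rewrite dv0 mul1r u0 add0r => {}E; rewrite -[RHS]E; apply: eq_bigr => l _.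
    by rewrite e'_dv // -scalerAr.
  by rewrite scaler_eq0 (negPf (lower_coef_neq0 _ _)) => /eqP.
case=> [_|k]; last by rewrite ltnS; exact: uS.
move: E; rewrite big_ord_recl dv0 mul1r big1 ?addr0 // => l _.
by rewrite uS ?mulr0.
Qed.

(** Left multiplication by a generator raises the order of nilpotency by at most one. *)
Lemma e'_nilpotent i x : exists N, iter N (e' i) x = 0.
Proof.
have iter0 N : iter N (e' i) 0 = 0 by elim: N => //= N ->; rewrite linear0.
have iter_add N x1 x2 : iter N (e' i) (x1 + x2) = iter N (e' i) x1 + iter N (e' i) x2.
  by elim: N => //= N ->; rewrite linearD.
have iterZ N c x1 : iter N (e' i) (c *: x1) = c *: iter N (e' i) x1.
  by elim: N => //= N ->; rewrite linearZ.
have mulF j N x1 : iter N (e' i) x1 = 0 -> iter N.+1 (e' i) (F j * x1) = 0.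
  elim: N x1 => [|N IH] x1 /=; first by move=> ->; rewrite mulr0 linear0.
  rewrite -iterS iterSr => xN; rewrite -[e' i (e' i _)]/(iter N.+2 (e' i) (F j * x1)).
  rewrite iterSr qm_e'F iter_add !iterZ IH // scaler0 addr0.
  by rewrite iterSr xN scaler0.
have [s ->] := qm_gen x; elim: s => [|[c w] s [N IH]].
  by exists 0%N; rewrite /= big_nil.
have [N' IH'] : exists N', iter N' (e' i) (\prod_(j <- w) F j) = 0.
  elim: w => [|j w [N' IH']].
    by exists 1%N; rewrite big_nil /= qm_e'1.
  by exists N'.+1; rewrite big_cons mulF.
exists (N + N')%N; rewrite big_cons iter_add iterZ.
by rewrite ssrnat.iterD IH' iter0 scaler0 add0r addnC ssrnat.iterD IH iter0.
Qed.

Lemma string_decomp_exists i x : exists m u, string_decomp i x m u.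
Proof.
have [N] := e'_nilpotent i x; elim: N x => [|N IH] x.
  move=> /= ->; exists 0%N, (fun=> 0); rewrite /string_decomp big_ord0.
  by split=> // k; rewrite linear0.
rewrite iterSr => /IH[m [u [u0 E]]].
(* A decomposition of e'_i x is lifted to [y] with e'_i y = e'_i x; the remainder [x - y] becomes
   the new term of index 0. *)
pose u' k := (lower_coef i k)^-1 *: u k.
have u'0 k : e' i (u' k) = 0 by rewrite linearZ /= u0 scaler0.
pose y := \sum_(k < m) dv i k.+1 * u' k.
have yx : e' i (x - y) = 0.
  rewrite linearB /= E linear_sum; apply/eqP; rewrite subr_eq0; apply/eqP.
  apply: eq_bigr => k _; rewrite e'_dv // -scalerAr scalerA divff ?scale1r //.
  exact: lower_coef_neq0.
exists m.+1, (fun k => if k is k'.+1 then u' k' else x - y); split=> [[|k] //|].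
by rewrite big_ord_recl dv0 mul1r subrK.
Qed.

(** Values of [u] beyond [m] are arbitrary; setting them to 0 allows decompositions of different
    lengths to be compared. *)
Lemma string_decomp_pad i x m u M : (m <= M)%N -> string_decomp i x m u ->
  let u' := fun k => if (k < m)%N then u k else 0 in
  string_decomp i x M u' /\
  \sum_(k < M) dv i k.+1 * u' k = \sum_(k < m) dv i k.+1 * u k.
Proof.
move=> mM [u0 E] u'.
have pad (G : nat -> A) : \sum_(k < M) G k * u' k = \sum_(k < m) G k * u k.
  rewrite (big_ord_widen M (fun k => G k * u k) mM) [RHS]big_mkcond /=.
  by apply: eq_bigr => k _; rewrite /u'; case: ifP; rewrite ?mulr0.
split; last exact: (pad (fun k => dv i k.+1)).
by split=> [k|]; rewrite /u'; [case: ifP; rewrite ?linear0 | rewrite (pad (dv i))].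
Qed.

Lemma ftildeE i x m u : string_decomp i x m u ->
  ftilde i x = \sum_(k < m) dv i k.+1 * u k.
Proof.
move=> dec; apply: xget_unique; first by exists m, u.
move=> y [m' [u' [dec' ->]]].
have [[v0 vE] <-] := string_decomp_pad (leq_addr m' m) dec.
have [[v'0 v'E] <-] := string_decomp_pad (leq_addl m m') dec'.
pose v k := if (k < m)%N then u k else 0; pose v' k := if (k < m')%N then u' k else 0.
have vv' k : (k < m + m')%N -> v k - v' k = 0.
  apply: (@string_decomp_eq0 i (m + m') (fun k => v k - v' k)) => [l|].
    by rewrite linearB /= v0 v'0 subr0.
  rewrite -[RHS](subrr x) {1}vE v'E -sumrB.
  by apply: eq_bigr => l _; rewrite mulrBr.
apply: eq_bigr => k _; congr (_ * _); apply/esym/eqP.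
by rewrite -subr_eq0 vv'.
Qed.

Lemma ftildeD i x y : ftilde i (x + y) = ftilde i x + ftilde i y.
Proof.
have [m [u dx]] := string_decomp_exists i x; have [m' [u' dy]] := string_decomp_exists i y.
have [dx' _] := string_decomp_pad (leq_addr m' m) dx.
have [dy' _] := string_decomp_pad (leq_addl m m') dy.
rewrite (ftildeE dx') (ftildeE dy'); case: dx' dy' => u0 uE [u'0 u'E].
pose v k := if (k < m)%N then u k else 0; pose v' k := if (k < m')%N then u' k else 0.
have dxy : string_decomp i (x + y) (m + m') (fun k => v k + v' k).
  split=> [k|]; first by rewrite linearD /= u0 u'0 addr0.
  by rewrite {1}uE {1}u'E -big_split; apply: eq_bigr => k _; rewrite mulrDr.
by rewrite (ftildeE dxy) -big_split; apply: eq_bigr => k _; rewrite mulrDr.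
Qed.

Lemma ftildeZ i c x : ftilde i (c *: x) = c *: ftilde i x.
Proof.
have [m [u dx]] := string_decomp_exists i x.
have dcx : string_decomp i (c *: x) m (fun k => c *: u k).
  case: dx => u0 ->; split=> [k|]; first by rewrite linearZ /= u0 scaler0.
  by rewrite scaler_sumr; apply: eq_bigr => k _; rewrite scalerAr.
rewrite (ftildeE dx) (ftildeE dcx) scaler_sumr.
by apply: eq_bigr => k _; rewrite scalerAr.
Qed.

Lemma latticeD x y : lattice x -> lattice y -> lattice (x + y).
Proof.
move=> [s [rs ->]] [s' [rs' ->]]; exists (s ++ s'); rewrite big_cat; split=> // p.
by rewrite mem_cat => /orP[/rs|/rs'].
Qed.

Lemma latticeN x : lattice x -> lattice (- x).
Proof.
move=> [s [rs ->]]; exists [seq (- p.1, p.2) | p <- s]; split.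
  by move=> _ /mapP[p /rs rp ->]; exact: regular0_opp.
by rewrite big_map -sumrN; apply: eq_bigr => p _; rewrite scaleNr.
Qed.

Lemma ftilde_lattice i x : lattice x -> lattice (ftilde i x).
Proof.
move=> [s [rs ->]]; exists [seq (p.1, i :: p.2) | p <- s]; split.
  by move=> _ /mapP[p /rs rp ->].
rewrite big_map (big_morph _ (ftildeD i) (_ : ftilde i 0 = 0)); last first.
  by have := ftildeZ i 0 0; rewrite !scale0r.
by apply: eq_bigr => p _; rewrite ftildeZ.
Qed.

Lemma qlatticeD x y : qlattice x -> qlattice y -> qlattice (x + y).
Proof.
by move=> [x' lx <-] [y' ly <-]; exists (x' + y'); [exact: latticeD | rewrite scalerDr].
Qed.

Lemma qlatticeN x : qlattice x -> qlattice (- x).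
Proof. by move=> [x' lx <-]; exists (- x'); [exact: latticeN | rewrite scalerN]. Qed.

Lemma qlattice0 : qlattice (0 : A).
Proof.
exists 0; last by rewrite scaler0.
by exists [::]; rewrite big_nil.
Qed.

Lemma lclass_eq x y : lclass x = lclass y <-> qlattice (x - y).
Proof.
split=> [E|xy].
  have : lclass x x by rewrite /lclass /= subrr; exact: qlattice0.
  by rewrite E.
apply/seteqP; split=> z /= zx.
  by rewrite /lclass /= -[z](subrK x) -addrA; exact: (qlatticeD zx xy).
rewrite /lclass /= -[z](subrK y) -addrA; apply: (qlatticeD zx).
by rewrite -opprB; exact: qlatticeN.
Qed.

(** The representative chosen by [on_classes] differs from [fword Q s] by an element of qL, and f~_i
    maps qL to itself by linearity. *)
Lemma Binf_ftilde i b b' : Binf b -> on_classes (Q := Q) (ftilde i) b = Some b' -> Binf b'.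
Proof.
move=> [s [bE nz]]; rewrite /on_classes /pick_some; case: pselect => // ex [] <-.
case: cid => {}b' /= [x [lx bx nfx ->]].
have : qlattice (x - fword Q s) by apply/lclass_eq; rewrite -bx -bE.
move=> [y ly yE]; have fE : qlattice (ftilde i x - fword Q (i :: s)).
  exists (ftilde i y); first exact: ftilde_lattice.
  by rewrite -ftildeZ yE ftildeD -scaleN1r ftildeZ scaleN1r.
exists (i :: s); split; first exact/lclass_eq.
by move=> fw; apply: nfx; rewrite -[ftilde _ _](subrK (fword Q (i :: s))); exact: (qlatticeD fE fw).
Qed.

(** The counit of U_q^-, used to separate 1 from qL. *)
Definition augmentation (g : A -> Qq) : Prop :=
  [/\ forall x y, g (x + y) = g x + g y, forall c x, g (c *: x) = c * g x,
      g 1 = 1, forall x y, g (x * y) = g x * g y & forall i, g (F i) = 0].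

Lemma augmentation_exists : exists g, augmentation g.
Proof.
have [|aug augF] := @qm_univ I a Q Qq^o (fun=> 0).
  (* Each term of a Serre relation contains the factor F_j, here 0. *)
  by move=> i j ij m; rewrite big1 // => k _; rewrite mulr0 mul0r scaler0.
exists (aug : A -> Qq); split=> [x y|c x||x y|i].
- exact: linearD.
- exact: (linearZ_LR aug).
- exact: rmorph1.
- exact: rmorphM.
- exact: augF.
Qed.

Section Augmentation.
Variable g : A -> Qq.
Hypothesis gP : augmentation g.

Lemma aug0 : g 0 = 0.
Proof. by case: gP => _ gZ _ _ _; rewrite -(scale0r (0 : A)) gZ mul0r. Qed.

Lemma aug_sum (J : Type) (s : seq J) (G : J -> A) :
  g (\sum_(p <- s) G p) = \sum_(p <- s) g (G p).
Proof. by case: gP => gD _ _ _ _; exact: (big_morph _ gD aug0). Qed.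

Lemma aug_fword s : g (fword Q s) = (s == [::])%:R.
Proof.
case: gP => gD gZ g1 gM gF; case: s => [|i s] //=.
have [m [u dx]] := string_decomp_exists i (fword Q s).
rewrite (ftildeE dx) aug_sum big1 // => k _.
by rewrite gM /qdivided /divided gZ exprS gM gF mul0r mulr0 mul0r.
Qed.

Lemma aug_lattice x : lattice x -> regular0 (g x).
Proof.
case: gP => gD gZ g1 gM gF; move=> [s [rs ->]]; rewrite aug_sum big_seq.
apply: (big_ind regular0) => [|c c'|p /rs rp]; [exact: regular0_0 | exact: regular0_add |].
rewrite gZ aug_fword; case: eqP => _; first by rewrite mulr1.
by rewrite mulr0; exact: regular0_0.
Qed.

(** The counit maps L into functions regular at q = 0, so on 1 + qL it takes values of the form 1 +
    q c with c regular. *)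
Lemma aug_unit x : qlattice (x - 1) -> g x <> 0.
Proof.
case: gP => gD gZ g1 gM gF [y ly E] x0.
have /eqP := qvar_regular_neq1 (regular0_opp (aug_lattice ly)); apply.
by rewrite mulrN -gZ E gD x0 add0r -scaleN1r gZ g1 mulr1 opprK.
Qed.

End Augmentation.

Lemma b_inf_Binf : Binf (b_inf Q).
Proof.
have [g gP] := augmentation_exists.
exists [::]; split=> // q1; apply: (aug_unit gP (x := 0)); last exact: aug0 gP.
by rewrite sub0r; exact: qlatticeN.
Qed.

(** A representative of nonzero degree is a combination of nonempty words, which the counit
    kills. *)
Lemma qdeg_b_inf d : qdeg_is (b_inf Q) d -> d = [ffun=> 0%N].
Proof.
have [g gP] := augmentation_exists.
move=> [x [lx [s [sd xE]] /esym/lclass_eq /(aug_unit gP) gx]].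
apply: contrapT => d0; apply: gx; rewrite xE (aug_sum gP) big_seq big1 // => p ps.
case: gP => gD gZ g1 gM gF; rewrite gZ; case E : p.2 => [|i w].
  by case: d0; rewrite -(sd _ ps) E; apply/ffunP => i; rewrite !ffunE.
by rewrite big_cons gM gF mul0r mulr0.
Qed.

End QuantumStrings.

(** * The theorem *)

Lemma pick_someP (T : Type) (P : T -> Prop) : (exists x, P x) ->
  exists2 y, pick_some P = Some y & P y.
Proof.
move=> ex; rewrite /pick_some; case: pselect => // h.
by exists (projT1 (cid h)) => //; exact: projT2 (cid h).
Qed.

Lemma pick_some_eq (T : Type) (P : T -> Prop) y : pick_some P = Some y -> P y.
Proof. by rewrite /pick_some; case: pselect => // h [<-]; exact: projT2 (cid h). Qed.

Section Valuation.
Variables (R : realType) (r : nat) (p : {mpoly R[i][r]}).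

Lemma mem_exponents (t : r.-tuple nat) :
  ((t : r.-tuplelexi nat) \in exponents p) = (p@_[multinom t] != 0).
Proof.
rewrite -mcoeff_msupp; apply/mapP/idP => [[m mp ->]|tp]; last by exists [multinom t].
by rewrite (_ : [multinom m] = m) //; case: (m).
Qed.

Lemma mem_rev_exponents (t : r.-tuple nat) :
  ((t : r.-tuplelexi nat) \in rev_exponents p)
  = (p@_[multinom [tuple of rev t]] != 0).
Proof.
rewrite -mcoeff_msupp; apply/mapP/idP => [[m mp ->]|tp].
  rewrite (_ : [multinom _] = m) //; case: (m) => x /=; congr Multinom.
  by apply: val_inj; rewrite /= revK.
exists [multinom [tuple of rev t]] => //.
by apply: val_inj; rewrite /= revK.
Qed.

End Valuation.

Section Main.
Variables (R : realType) (n : nat) (I : finType) (D : pinned_group R n I).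
Variables (Q : quantum_minus (cartan D)) (Bup : set ('M[R[i]]_n.+1 -> R[i])).
Hypothesis Bup_perfect : perfect_basis D Bup.
Variable Xi : cr_sort (Binf_crystal Q) -> cr_sort (perfect_crystal D Bup).
Hypothesis Xi_iso : crystal_iso Xi.
Hypothesis action_positive : forall (b : cr_sort (Binf_crystal Q)) (k : I),
  cr_elt b ->
  combination [set c | 0 <= c] Bup (fun u => - act D k (Xi b) u).
Hypothesis product_positive : forall (b bk : cr_sort (Binf_crystal Q)) (k : I),
  cr_elt b -> cr_f k (b_inf Q) = Some bk ->
  combination [set c | 0 <= c] Bup (fun u => Xi bk u * Xi b u).

Let cartan_diag : forall k, cartan D k k = 2 := pg_cartan_diag D.

Lemma Xi_b_inf : [/\ Bup (Xi (b_inf Q)), homogeneous D (Xi (b_inf Q)) [ffun=> 0%N]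
  & pairing D (Xi (b_inf Q)) [::] = 1].
Proof.
have Sb := ci_elt Xi_iso (b_inf_Binf Q cartan_diag).
have wtE := ci_wt Xi_iso (b_inf_Binf Q cartan_diag).
(* Whether [xget] finds a degree or falls back on its default, the result is 0. *)
have q0 : xget [ffun=> 0%N] (qdeg_is (b_inf Q)) = [ffun=> 0%N].
  by case: xgetP => // d _ /(qdeg_b_inf cartan_diag).
have [d hd] := pb_homogeneous Bup_perfect Sb.
have := xgetPex [ffun=> 0%N] (ex_intro _ d hd).
move: wtE; rewrite /= q0; set d' := xget _ _ => wtE hd'.
have d'0 : d' = [ffun=> 0%N].
  apply/ffunP => k; have := congr1 (fun w : {ffun I -> int} => w k) wtE.
  by rewrite !ffunE => /oppr_inj [].
rewrite d'0 in hd'; split=> //.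
have [tau0 [t01 H]] := pb_degree0 Bup_perfect.
by have -> : Xi (b_inf Q) = tau0 by apply/H.
Qed.

Lemma act_positive tau k : Bup tau ->
  combination [set c : R[i] | 0 <= c] Bup (fun u => - act D k tau u).
Proof. by case/(ci_surj Xi_iso) => b bB <-; exact: action_positive. Qed.

Lemma mul_positive k : exists x, [/\ CU D x, pairing D x [:: k] <> 0,
    forall j, j <> [:: k] -> pairing D x j = 0
  & forall tau, Bup tau ->
      combination [set c : R[i] | 0 <= c] Bup (fun u => x u * tau u)].
Proof.
have [S0 h0 p1] := Xi_b_inf.
have [x [Sx xE xk x0]] := letter_basis Bup_perfect k S0 h0 p1.
exists x; split=> //; first exact: basis_CU Bup_perfect _ Sx.
move=> tau /(ci_surj Xi_iso)[b bB <-].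
(* The image of f~_k b_inf is some [y] with e~_k y equal to the unit; injectivity of e~_k identifies
   it with [x]. *)
have := ci_f Xi_iso k (b_inf_Binf Q cartan_diag) => /=.
have [y -> yE] := pick_someP (ex_intro (etilde_rel D Bup k ^~ (Xi (b_inf Q))) _ xE).
case E : (on_classes _ _) => [bk|] //= [yX].
rewrite (pb_etilde_inj Bup_perfect xE yE) yX.
exact: (product_positive bB E).
Qed.

Local Notation expo := (exponent (fun tau j => pairing D tau j <> 0)).

(** A letter with power 0 prepends the entry 0, and each f~_k raises it by one; starting from the
    unit, this yields an exponent. *)
Lemma demazure_exponent (j : seq I) (a : seq nat) b : size a = size j ->
  foldr (fun ja => iter ja.2 (obind (@cr_f _ (Binf_crystal Q) ja.1)))
    (Some (b_inf Q)) (zip j a) = Some b ->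
  Binf b /\ exists a', expo j (Xi b) a'.
Proof.
elim: j a b => [|k j IH] [|e a] b //=.
  move=> _ [<-]; split; first exact: b_inf_Binf.
  exists [::]; split=> //=; have [_ _ ->] := Xi_b_inf.
  by apply/eqP; exact: oner_neq0.
move=> [sa]; elim: e b => [|e IHe] b /=.
  move/(IH _ _ sa) => [Bb [a' [sa' wa]]]; split=> //.
  by exists (0%N :: a'); split=> //=; rewrite sa'.
case E : (iter _ _ _) => [b'|] //= fb; have [Bb' [a' Ma']] := IHe _ E.
split; first exact: Binf_ftilde cartan_diag _ _ _ Bb' fb.
have low : etilde_rel D Bup k (Xi b) (Xi b').
  by have := ci_f Xi_iso k Bb'; rewrite /= fb /=; exact: pick_some_eq.
exists (incr_nth a' 0); apply: (exponent_raise _ low Ma').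
by move=> k' tau tau0 j'; exact: etilde_act Bup_perfect act_positive _ _ _ _.
Qed.

Lemma basis_extremal (j : seq I) tau : Bup tau -> (exists a, expo j tau a) ->
  exists2 m, expo j tau m &
    forall a, expo j tau a -> lexle a m && lexle (rev m) (rev a).
Proof.
apply: (@extremal_exponent _ _ Bup _ (etilde_rel D Bup) _ _ _ (string_length D)).
- by move=> k tau' tau0 [].
- by move=> k tau' tau0 j'; exact: etilde_act Bup_perfect act_positive _ _ _ _.
- by move=> k tau' tau0 j'; exact: etilde_delete Bup_perfect act_positive mul_positive _ _ _ _.
- by move=> k tau'; exact: string_length_exists.
- by move=> k tau' j' [_ nr] nz; apply: nr; exists j'.
- move=> k tau' e St' se; have [tau0 E] := etilde_exists Bup_perfect St' se.
  exists tau0; split=> //; have [m [c [sm s0 _ _]]] := etildeP Bup_perfect E.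
  by have [->] := string_length_uniq se sm.
Qed.

End Main.

Theorem theorem5p1 (R : realType) (n : nat) (I : finType)
    (D : pinned_group R n I)
    (w : 'M[R[i]]_n.+1) (r : nat) (i : r.-tuple I)
    (i_reduced : reduced_word D i w)
    (Q : quantum_minus (cartan D))
    (Bup : set ('M[R[i]]_n.+1 -> R[i]))
    (Bup_perfect : perfect_basis D Bup)
    (Xi : cr_sort (Binf_crystal Q) -> cr_sort (perfect_crystal D Bup))
    (Xi_iso : crystal_iso Xi)
    (action_positive : forall (b : cr_sort (Binf_crystal Q)) (k : I),
      cr_elt b ->
      combination [set c | 0 <= c] Bup (fun u => - act D k (Xi b) u))
    (product_positive : forall (b bk : cr_sort (Binf_crystal Q)) (k : I),
      cr_elt b -> cr_f k (b_inf Q) = Some bk ->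
      combination [set c | 0 <= c] Bup (fun u => Xi bk u * Xi b u)) :
  forall b : cr_sort (Binf_crystal Q), demazure (b_inf Q) i b ->
    let Xi_w := restriction (Um_schubert D w) (Xi b) in
    let p := pullback D i (Xi b) in
    [/\ in_coordinates D w i Xi_w p, p != 0,
        v_low p = - op (vt_high p) & vt_low p = - op (v_high p)].
Proof.
move=> b [Bb [a fa]] Xi_w p.
pose expo := exponent (fun (tau : 'M[R[i]]_n.+1 -> R[i]) j => pairing D tau j <> 0).
have St : Bup (Xi b) := ci_elt Xi_iso Bb.
have ct := basis_CU Bup_perfect St.
have sa : size a = size i by rewrite !size_tuple.
have [_ ex] := demazure_exponent Bup_perfect Xi_iso action_positive sa fa.
have coefE (t : r.-tuple nat) :
    (p@_[multinom t] != 0) = (pairing D (Xi b) (word i t) != 0).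
  exact: pullback_mcoeff.
have expoE (t : r.-tuple nat) : p@_[multinom t] != 0 ->
    expo i (Xi b) t.
  by rewrite coefE => /eqP nz; split; rewrite ?size_tuple.
have extremal := basis_extremal Bup_perfect Xi_iso action_positive product_positive.
(* [m1] is the common extremum behind the second identity. *)
have [m1 [sm1 wm1] m1P] := extremal _ _ St ex.
rewrite size_tuple in sm1; move/eqP: sm1 => sm1.
have pm1 : p@_[multinom (Tuple sm1)] != 0 by rewrite coefE; exact/eqP.
have [Ss starE] := star_basis Bup_perfect St.
have starM (t : seq nat) : size t = r ->
    pairing D (star D (Xi b)) (word (rev i) (rev t)) = pairing D (Xi b) (word i t).
  by move=> st; rewrite starE word_rev ?revK ?size_tuple.
(* Exponents of the starred element for the reversed word are the reversed exponents of [Xi b]; so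
   [rev m1] is one of them, and [rev m2] gives the first identity. *)
have [|m2 [sm2 wm2] m2P] := extremal (rev i) _ Ss.
  exists (rev m1); split; first by rewrite !size_rev (eqP sm1) size_tuple.
  by rewrite starM //; exact/eqP.
rewrite size_rev size_tuple in sm2; move/eqP: sm2 => sm2.
have pm2 : p@_[multinom [tuple of rev (Tuple sm2)]] != 0.
  rewrite coefE -starM ?size_tuple //= revK; exact/eqP.
split.
- move=> t ut; rewrite /Xi_w /restriction asboolT // /p pullback_meval //.
- by apply: contraNneq pm1 => ->; rewrite mcoeff0.
- rewrite /v_low /vt_high (@lexminP _ _ [tuple of rev (Tuple sm2)]).
  + rewrite (@lexmaxP _ _ (Tuple sm2)).
    * by rewrite op_opp opprK op_int_vector.
    * by rewrite mem_rev_exponents.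
    * move=> t; rewrite mem_rev_exponents tuplelexi_lexle => /expoE[st wt].
      suff /m2P/andP[] : expo (rev i) (star D (Xi b)) t by [].
      split; first by rewrite size_rev !size_tuple.
      by rewrite -[tval t]revK starM ?size_rev ?size_tuple.
  + by rewrite mem_exponents.
  + move=> t; rewrite mem_exponents tuplelexi_lexle => /expoE[st wt].
    suff /m2P/andP[_] : expo (rev i) (star D (Xi b)) (rev t) by rewrite revK.
    by split; [rewrite !size_rev !size_tuple | rewrite starM ?size_tuple].
- rewrite /vt_low /v_high (@lexminP _ _ [tuple of rev (Tuple sm1)]).
  + rewrite (@lexmaxP _ _ (Tuple sm1)).
    * by rewrite op_opp opprK op_int_vector.
    * by rewrite mem_exponents.
    * by move=> t; rewrite mem_exponents tuplelexi_lexle => /expoE/m1P/andP[].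
  + rewrite mem_rev_exponents (_ : [tuple of rev _] = Tuple sm1) //.
    by apply: val_inj; rewrite /= revK.
  + move=> t; rewrite mem_rev_exponents tuplelexi_lexle => /expoE/m1P/andP[_].
    by rewrite /= revK.
Qed.
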